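(* For each integer $n\ge0$ let $\mathcal{T}op_{\le n}$ be the left Bousfield localization of the model category $\mathcal{T}op$ of topological spaces with respect to the set of maps $\{S^k\to\ast\mid k>n\}$, and consider the diagram of left Quillen functors (identity functors) $$\cdots\to\mathcal{T}op_{\le3}\to\mathcal{T}op_{\le2}\to\mathcal{T}op_{\le1}\to\mathcal{T}op_{\le0}$$ with homotopy limit $\mathcal Lim_n\mathcal{T}op_{\le n}$. Then $\mathcal{T}op$ is equivalent (up to weak equivalence) to $\mathcal Lim_n\mathcal{T}op_{\le n}$, via the functor $\mathcal{T}op\to\mathcal Lim_n\mathcal{T}op_{\le n}$ sending a space to the constant tower on it and the functor $\mathcal Lim_n\mathcal{T}op_{\le n}\to\mathcal{T}op$ sending a tower $\cdots\to X_2\to X_1\to X_0$ to its homotopy limit $\mathrm{holim}_nX_n$ in $\mathcal{T}op$. That is: (1) for every space $X$, the homotopy limit of the constant tower on $X$ is weakly equivalent to $X$; (2) every object $\cdots\to X_2\to X_1\to X_0$ of $\mathcal Lim_n\mathcal{T}op_{\le n}$ is weakly equivalent to the constant tower on $\mathrm{holim}_mX_m$; that is, $\mathrm{holim}_mX_m$ is $n$-equivalent to $X_n$ for all $n\ge0$.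
   Context: An $n$-equivalence is a map of spaces $X\to Y$ inducing isomorphisms $\pi_i(X)\to\pi_i(Y)$ for all $i\le n$ (and all basepoints); these are the weak equivalences of $\mathcal{T}op_{\le n}$. The homotopy limit $\mathcal Lim_n\mathcal{T}op_{\le n}$ of the displayed diagram is the category whose objects are towers of spaces $\cdots\to X_3\to X_2\to X_1\to X_0$ in which each map $X_{n+1}\to X_n$ is an $n$-equivalence, with morphisms the families of maps $X_n\to Y_n$ ($n\ge0$) making the resulting diagram commute; a morphism is a weak equivalence if $X_n\to Y_n$ is an $n$-equivalence for every $n\ge0$. *)

(* Defs.v *)
From Stdlib Require Import Relations.
From HB Require Import structures.
From mathcomp Require Import all_boot all_order all_algebra generic_quotient.
From mathcomp Require Import all_classical all_reals topology normedtype.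
From mathcomp Require Import homotopy.

Set Implicit Arguments.
Unset Strict Implicit.
Unset Printing Implicit Defensive.
Import Order.TTheory GRing.Theory Num.Theory numFieldNormedType.Exports.
Local Open Scope classical_set_scope.
Local Open Scope ring_scope.
Local Open Scope quotient_scope.

Section UnitInterval.
Context {R : realType}.

Definition unitI : Type := set_type [set` `[0%R : R, 1%R]].

HB.instance Definition _ := Topological.copy unitI (set_type [set` `[0%R : R, 1%R]]).

Lemma clampP (x : R) : Num.max 0 (Num.min 1 x) \in [set` `[0 : R, 1]].
Proof.
by apply/mem_set; rewrite /= in_itv /= le_max lexx /= ge_max ler01 ge_min lexx.
Qed.

(* retraction of the line onto [0, 1], used to reparametrize homotopies *)
Definition clamp (x : R) : unitI := exist _ (Num.max 0 (Num.min 1 x)) (clampP x).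

Definition uval (s : unitI) : R := set_val s.

Lemma uval_inj : injective uval.
Proof. by move=> s t /eq_sig_hprop; apply=> ? ? ?; apply: eq_irrelevance. Qed.

Lemma uval_itv (s : unitI) : 0 <= uval s <= 1.
Proof. by case: s => x /= xI; move: (set_mem xI); rewrite /= in_itv. Qed.

Lemma uval_clamp (x : R) : 0 <= x <= 1 -> uval (clamp x) = x.
Proof.
move=> /andP[x0 x1]; rewrite /uval /clamp set_valE /=.
by rewrite (min_idPr x1) (max_idPr x0).
Qed.


Lemma uval_continuous : continuous uval.
Proof. exact: initial_continuous. Qed.

Lemma clamp_continuous : continuous clamp.
Proof.
apply: continuous_comp_initial => x.
apply: (@continuous_max R R (cst 0) (fun y : R => Num.min 1 y) x).
  exact: cvg_cst.
by apply: (@continuous_min R R (cst 1) id x); [exact: cvg_cst|exact: cvg_id].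
Qed.

HB.instance Definition _ := isContinuous.Build R unitI clamp clamp_continuous.

Lemma clamp01_neq : clamp 0 != clamp 1.
Proof.
apply/eqP => /(congr1 uval); rewrite !uval_clamp ?lexx ?ler01//.
by move/eqP; rewrite eq_sym oner_eq0.
Qed.

HB.instance Definition _ := isBiPointed.Build unitI clamp01_neq.

Lemma uval0 : uval zero = 0.
Proof. by rewrite uval_clamp// lexx ler01. Qed.

Lemma uval1 : uval one = 1.
Proof. by rewrite uval_clamp// lexx ler01. Qed.

End UnitInterval.
Arguments unitI R : clear implicits.

Section Homotopy.
Context {R : realType} {K X : topologicalType}.
Implicit Types (A : set K) (f g h : continuousType K X).

(* homotopy from f to g through maps agreeing with f (hence with g) on A *)
Definition homotopic_rel A f g : Prop :=
  exists H : continuousType (K * unitI R)%type X,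
    [/\ forall k, H (k, zero) = f k,
        forall k, H (k, one) = g k
      & forall k s, A k -> H (k, s) = f k].

Lemma homotopic_rel_refl A f : homotopic_rel A f f.
Proof.
have cH : continuous (fun p : K * unitI R => f p.1).
  by move=> p; apply: continuous_comp; [exact: cvg_fst|exact: cts_fun].
by exists (mkcts cH).
Qed.

Lemma reparam_continuous (H : continuousType (K * unitI R)%type X)
    (a : R -> R) : continuous a ->
  continuous (fun p : K * unitI R => H (p.1, clamp (a (uval p.2)))).
Proof.
move=> ca p; apply: (@continuous_comp _ _ _
  (fun p : K * unitI R => (p.1, clamp (a (uval p.2)))) H); last exact: cts_fun.
apply: (@cvg_pair _ _ _ (nbhs p) (nbhs p.1) (nbhs (clamp (a (uval p.2)))) _ _ _
  fst (fun q => clamp (a (uval q.2)))); first exact: cvg_fst.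
apply: (@continuous_comp _ _ _ (fun p : K * unitI R => uval p.2)
  (fun x => clamp (a x))).
  apply: (@continuous_comp _ _ _ snd uval); first exact: cvg_snd.
  exact: uval_continuous.
by apply: (@continuous_comp _ _ _ a clamp); [exact: ca|exact: clamp_continuous].
Qed.

Lemma homotopic_rel_sym A f g : homotopic_rel A f g -> homotopic_rel A g f.
Proof.
move=> [H [H0 H1 HA]].
have cr : continuous (fun x : R => 1 - x).
  by move=> x; apply: cvgB; [exact: cvg_cst|exact: cvg_id].
exists (mkcts (reparam_continuous (H := H) cr)); split=> [k|k|k s Ak] /=.
- by rewrite /mkcts uval0 subr0.
- by rewrite /mkcts uval1 subrr.
- by rewrite /mkcts/= HA// -H1 HA.
Qed.

Lemma homotopic_rel_trans A f g h :
  homotopic_rel A f g -> homotopic_rel A g h -> homotopic_rel A f h.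
Proof.
move=> [F [F0 F1 FA]] [G [G0 G1 GA]].
have ca : continuous (fun x : R => 2 * x).
  by move=> x; apply: cvgM; [exact: cvg_cst|exact: cvg_id].
have cb : continuous (fun x : R => 2 * x - 1).
  by move=> x; apply: cvgB; [exact: ca|exact: cvg_cst].
have cF := reparam_continuous (H := F) ca.
have cG := reparam_continuous (H := G) cb.
set F' := (fun p => F _) in cF; set G' := (fun p => G _) in cG.
pose v (p : K * unitI R) : R := uval p.2.
have cv : continuous v.
  move=> p; apply: (@continuous_comp _ _ _ snd uval); first exact: cvg_snd.
  exact: uval_continuous.
pose L := [set p | v p <= 2^-1]; pose U := [set p | 2^-1 <= v p].
have cL : closed L.
  by apply: (@preimage_closed _ _ v [set x | x <= 2^-1]) => //; exact: closed_le.
have cU : closed U.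
  by apply: (@preimage_closed _ _ v [set x | 2^-1 <= x]) => //; exact: closed_ge.
pose H p := if v p <= 2^-1 then F' p else G' p.
have LU : L `|` U = setT.
  rewrite -subTset => p _; case: (leP (v p) 2^-1) => [?|/ltW ?]; by [left|right].
have cH : continuous H.
  apply/continuous_subspace_setT; rewrite -LU; apply: withinU_continuous => //.
    apply: (@subspace_eq_continuous _ L _ F'); last exact: continuous_subspaceT.
    by move=> p /set_mem Lp; rewrite /from_subspace /H ifT.
  apply: (@subspace_eq_continuous _ U _ G'); last exact: continuous_subspaceT.
  move=> p /set_mem Up; rewrite /from_subspace /H; case: ifP => // Lp.
  have vE : uval p.2 = 2^-1 by apply/eqP; rewrite eq_le Up andbT; exact: Lp.
  rewrite /F' /G' vE divff ?pnatr_eq0// subrr.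
  by rewrite -/one -/zero F1 G0.
have h0 : 0 <= 2^-1 :> R by rewrite invr_ge0 ler0n.
have h1 : (1 <= 2^-1 :> R) = false.
  by apply/negbTE; rewrite -ltNge invf_lt1 ?ltr1n.
exists (mkcts cH); split=> [k|k|k s Ak].
- have := erefl (H (k, zero)).
  by rewrite {2}/H /v /F' /= uval0 h0 mulr0 -/zero F0.
- have := erefl (H (k, one)).
  by rewrite {2}/H /v /G' /= uval1 h1 mulr1 -[2]/(1 + 1) addrK -/one G1.
- have := erefl (H (k, s)).
  by rewrite {2}/H /F' /G' /=; case: ifP => _; rewrite ?FA ?GA// -F1 FA.
Qed.

End Homotopy.
Arguments homotopic_rel R {K X} A f g.

Section PathComponents.
Context (R : realType) (X : topologicalType).

Definition path_related (x y : X) : bool :=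
  `[< $|{path unitI R from x to y}| >].

Lemma path_relatedP (x y : X) :
  path_related x y <->
  homotopic_rel R (set0 : set (unitI R)) (cst x) (cst y).
Proof.
split=> [/asboolP[p]|[H [H0 H1 _]]].
  have cH : continuous (fun q : unitI R * unitI R => p q.2).
    by move=> q; apply: continuous_comp; [exact: cvg_snd|exact: cts_fun].
  by exists (mkcts cH); split=> [k|k|k s []] /=; rewrite /mkcts/= ?path_zero ?path_one.
apply/asboolP.
have cp : continuous (fun s : unitI R => H (zero, s)).
  move=> s; apply: (@continuous_comp _ _ _ (fun s : unitI R => (zero, s)) H);
    last exact: cts_fun.
  apply: (@cvg_pair _ _ _ (nbhs s) (nbhs zero) (nbhs s) _ _ _ (cst zero) id).
    exact: cvg_cst.
  exact: cvg_id.
exact: (squash (@mk_path (unitI R) X x y _ cp (H0 zero) (H1 zero)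
  : {path unitI R from x to y})).
Qed.

Lemma path_related_refl : reflexive path_related.
Proof. by move=> x; apply/path_relatedP; exact: homotopic_rel_refl. Qed.

Lemma path_related_sym : symmetric path_related.
Proof.
by move=> x y; apply/idP/idP => /path_relatedP xy; apply/path_relatedP;
  exact: homotopic_rel_sym.
Qed.

Lemma path_related_trans : transitive path_related.
Proof.
move=> y x z /path_relatedP xy /path_relatedP yz; apply/path_relatedP.
exact: homotopic_rel_trans xy yz.
Qed.

Canonical path_related_equiv :=
  EquivRel path_related path_related_refl path_related_sym path_related_trans.

(* the set of path components: it needs no base point, so it sees whether the
   space is empty *)
Definition pi0 := {eq_quot path_related}.

End PathComponents.

Section HomotopyGroups.
Context (R : realType).

Definition cube (n : nat) : topologicalType :=
  prod_topology (fun _ : 'I_n => unitI R).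

Definition cube_boundary (n : nat) : set (cube n) :=
  [set t | exists i, t i = zero \/ t i = one].

(* maps of pairs (I^n, boundary I^n) -> (X, x); pi_ n x below is their set of
   homotopy classes relative to the boundary *)
Definition loop (n : nat) (X : topologicalType) (x : X) :=
  {a : continuousType (cube n) X |
    `[< forall t, cube_boundary t -> a t = x >]}.

Section Quotient.
Context (n : nat) (X : topologicalType) (x : X).

Definition loop_homotopic (a b : loop n x) : bool :=
  `[< homotopic_rel R (@cube_boundary n) (val a) (val b) >].

Lemma loop_homotopic_refl : reflexive loop_homotopic.
Proof. by move=> a; apply/asboolP; exact: homotopic_rel_refl. Qed.

Lemma loop_homotopic_sym : symmetric loop_homotopic.
Proof.
by move=> a b; apply/idP/idP => /asboolP ab; apply/asboolP;
  exact: homotopic_rel_sym.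
Qed.

Lemma loop_homotopic_trans : transitive loop_homotopic.
Proof.
move=> b a c /asboolP ab /asboolP bc; apply/asboolP.
exact: homotopic_rel_trans ab bc.
Qed.

Canonical loop_homotopic_equiv := EquivRel loop_homotopic
  loop_homotopic_refl loop_homotopic_sym loop_homotopic_trans.

Definition pi_ := {eq_quot loop_homotopic}.

End Quotient.

Section Functoriality.
Context (X Y : topologicalType) (f : continuousType X Y).

Definition pi0_map (c : pi0 R X) : pi0 R Y := \pi_(pi0 R Y) (f (repr c)).

Lemma pi0_mapE (x : X) : pi0_map (\pi_(pi0 R X) x) = \pi_(pi0 R Y) (f x).
Proof.
have /eqmodP/asboolP[p] : repr (\pi_(pi0 R X) x) = x %[mod pi0 R X].
  by rewrite reprK.
apply/eqmodP/asboolP; exact: (squash ((f \o p) : {path _ from _ to _})).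
Qed.

Context (n : nat) (x : X).

Lemma loop_map_subproof (a : loop n x) :
  `[< forall t, cube_boundary t -> (f \o val a) t = f x >].
Proof. by apply/asboolP => t bt /=; rewrite (asboolW (valP a)). Qed.

Definition loop_map (a : loop n x) : loop n (f x) :=
  exist _ (f \o val a : continuousType _ _) (loop_map_subproof a).

Definition pi_map (c : pi_ n x) : pi_ n (f x) := \pi_(pi_ n (f x)) (loop_map (repr c)).

Lemma pi_mapE (a : loop n x) : pi_map (\pi_(pi_ n x) a) = \pi_(pi_ n (f x)) (loop_map a).
Proof.
have /eqmodP/asboolP[H [H0 H1 HA]] : repr (\pi_(pi_ n x) a) = a %[mod pi_ n x].
  by rewrite reprK.
apply/eqmodP/asboolP; exists (f \o H : continuousType _ _).
by split=> [k|k|k s Ak] /=; rewrite ?H0 ?H1 ?HA.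
Qed.

End Functoriality.

(* - pi_0 is treated separately, without base points, so that the inclusion of
     the empty space is not vacuously an equivalence.
   - For i > 0 the map pi_map f is a group homomorphism (composition with f
     commutes with concatenation of cubes), so it is an isomorphism if and only
     if it is bijective. *)
Definition n_equivalence (n : nat) (X Y : topologicalType)
    (f : continuousType X Y) : Prop :=
  bijective (pi0_map f) /\
  forall i, (0 < i <= n)%N -> forall x : X, bijective (@pi_map X Y f i x).

Definition weak_equivalence (X Y : topologicalType)
    (f : continuousType X Y) : Prop :=
  bijective (pi0_map f) /\
  forall i, (0 < i)%N -> forall x : X, bijective (@pi_map X Y f i x).

Lemma weak_equivalence_idfun (X : topologicalType) :
  weak_equivalence (idfun : continuousType X X).
Proof.
split=> [|i _ x]; exists id => c.
- by rewrite /pi0_map /= reprK.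
- by rewrite /pi0_map /= reprK.
- rewrite /pi_map -[RHS]reprK; congr (\pi _).
  by apply/val_inj/continuousEP.
- rewrite /pi_map -[RHS]reprK; congr (\pi _).
  by apply/val_inj/continuousEP.
Qed.

Lemma weak_equivalenceW (n : nat) (X Y : topologicalType)
  (f : continuousType X Y) : weak_equivalence f -> n_equivalence n f.
Proof. by move=> [f0 fi]; split=> // i /andP[i0 _]; exact: fi. Qed.

End HomotopyGroups.

(* a category with a class of weak equivalences *)
Record relCat := RelCat {
  obj :> Type;
  mor : obj -> obj -> Type;
  idm : forall a, mor a a;
  cmp : forall a b c, mor b c -> mor a b -> mor a c;
  weq : forall a b, mor a b -> Prop;
  cmpA : forall a b c d (h : mor c d) (g : mor b c) (f : mor a b),
    cmp h (cmp g f) = cmp (cmp h g) f;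
  cmp1m : forall a b (f : mor a b), cmp (idm b) f = f;
  cmpm1 : forall a b (f : mor a b), cmp f (idm a) = f
}.
Arguments mor {r} : rename.
Arguments idm {r} : rename.
Arguments cmp {r a b c} : rename.
Arguments weq {r a b} : rename.

(* connected by a finite zigzag of weak equivalences *)
Definition weakly_equivalent (C : relCat) : relation C :=
  clos_refl_sym_trans C (fun a b => exists f : mor a b, weq f).

Record functor (C D : relCat) := Functor {
  fobj :> C -> D;
  fmor : forall a b, mor a b -> mor (fobj a) (fobj b);
  fmor_idm : forall a, fmor (idm a) = idm (fobj a);
  fmor_cmp : forall a b c (g : mor b c) (f : mor a b),
    fmor (cmp g f) = cmp (fmor g) (fmor f)
}.
Arguments fmor {C D} f {a b} : rename.

Definition homotopical (C D : relCat) (F : functor C D) : Prop :=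
  forall (a b : C) (f : mor a b), weq f -> weq (fmor F f).

Program Definition id_functor (C : relCat) : functor C C :=
  @Functor C C id (fun _ _ f => f) _ _.
Next Obligation. by []. Qed.
Next Obligation. by []. Qed.

Program Definition comp_functor (C D E : relCat)
    (G : functor D E) (F : functor C D) : functor C E :=
  @Functor C E (G \o F) (fun _ _ f => fmor G (fmor F f)) _ _.
Next Obligation. by move=> C D E G F a /=; rewrite !fmor_idm. Qed.
Next Obligation. by move=> C D E G F a b c g f /=; rewrite !fmor_cmp. Qed.

Record natural_weq (C D : relCat) (F G : functor C D) := NaturalWeq {
  component : forall a, mor (F a) (G a);
  component_natural : forall a b (f : mor a b),
    cmp (component b) (fmor F f) = cmp (fmor G f) (component a);
  component_weq : forall a, weq (component a)
}.

(* connected by a finite zigzag of natural transformations whose components are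
   weak equivalences *)
Definition naturally_weakly_equivalent (C D : relCat) :
    relation (functor C D) :=
  clos_refl_sym_trans (functor C D) (fun F G => $|natural_weq F G|).

(* F and G preserve weak equivalences and are mutually inverse up to natural
   zigzags of weak equivalences *)
Definition homotopy_equivalence (C D : relCat)
    (F : functor C D) (G : functor D C) : Prop :=
  [/\ homotopical F, homotopical G,
      naturally_weakly_equivalent (comp_functor G F) (id_functor C) &
      naturally_weakly_equivalent (comp_functor F G) (id_functor D)].

Section Towers.
Context (R : realType).

Program Definition spaces
    (W : forall X Y : topologicalType, continuousType X Y -> Prop) : relCat :=
  @RelCat topologicalType (fun X Y => continuousType X Y)
    (fun X => (idfun : continuousType X X))
    (fun X Y Z g f => (g \o f : continuousType X Z)) W _ _ _.
Next Obligation. by move=> *; apply/continuousEP. Qed.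
Next Obligation. by move=> *; apply/continuousEP. Qed.
Next Obligation. by move=> *; apply/continuousEP. Qed.

Definition Top : relCat := spaces (@weak_equivalence R).

(* The left Bousfield localization of Top at the maps S^k -> * (k > n) has the
   same underlying category as Top, with the n-equivalences as weak
   equivalences; the comparison functors from Top_le n.+1 to Top_le n are
   identities. *)
Definition Top_le (n : nat) : relCat := spaces (@n_equivalence R n).

(* objects of the homotopy limit of the categories Top_le n; the bonding map
   from level n.+1 to level n is a weak equivalence of Top_le n *)
Record tower := Tower {
  level :> nat -> topologicalType;
  bond : forall n, continuousType (level n.+1) (level n);
  bond_weq : forall n, @weq (Top_le n) _ _ (bond n)
}.

Record tower_map (X Y : tower) := TowerMap {
  level_map :> forall n, continuousType (X n) (Y n);
  level_map_bond : forall n (x : X n.+1),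
    level_map n (bond X n x) = bond Y n (level_map n.+1 x)
}.

Lemma tower_mapP (X Y : tower) (f g : tower_map X Y) :
  (forall n, f n =1 g n) -> f = g.
Proof.
case: f g => [f fb] [g gb] /= fg.
have {}fg : f = g by apply: functional_extensionality_dep => n; apply/continuousEP/fg.
by rewrite -{}fg in gb *; congr TowerMap; exact: Prop_irrelevance.
Qed.

Program Definition tower_id (X : tower) : tower_map X X :=
  @TowerMap X X (fun n => (idfun : continuousType _ _)) _.
Next Obligation. by []. Qed.

Program Definition tower_comp (X Y Z : tower)
    (g : tower_map Y Z) (f : tower_map X Y) : tower_map X Z :=
  @TowerMap X Z (fun n => (g n \o f n : continuousType _ _)) _.
Next Obligation. by move=> X Y Z g f n x /=; rewrite !level_map_bond. Qed.

Program Definition Lim : relCat :=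
  @RelCat tower tower_map tower_id tower_comp
    (fun X Y f => forall n, @weq (Top_le n) _ _ (f n)) _ _ _.
Next Obligation. by move=> *; exact: tower_mapP. Qed.
Next Obligation. by move=> *; exact: tower_mapP. Qed.
Next Obligation. by move=> *; exact: tower_mapP. Qed.

Lemma const_bond_weq (X : topologicalType) n :
  @weq (Top_le n) _ _ (idfun : continuousType X X).
Proof. exact/weak_equivalenceW/weak_equivalence_idfun. Qed.

Definition const_tower (X : topologicalType) : tower :=
  @Tower (fun=> X) (fun=> (idfun : continuousType X X)) (const_bond_weq X).

Program Definition const_tower_map (X Y : topologicalType)
    (f : continuousType X Y) : tower_map (const_tower X) (const_tower Y) :=
  @TowerMap (const_tower X) (const_tower Y) (fun=> f) _.
Next Obligation. by []. Qed.

Program Definition const_functor : functor Top Lim :=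
  @Functor Top Lim const_tower const_tower_map _ _.
Next Obligation. by move=> *; exact: tower_mapP. Qed.
Next Obligation. by move=> *; exact: tower_mapP. Qed.

(* X^[0, 1] with the compact-open topology *)
Definition path_space (X : topologicalType) : Type := continuousType (unitI R) X.

HB.instance Definition _ (X : topologicalType) :=
  Topological.copy (path_space X)
    (@initial_topology (continuousType (unitI R) X)
       {compact-open, unitI R -> X} id).

Definition holim_ambient (X : tower) : topologicalType :=
  (prod_topology (fun n => X n) * prod_topology (fun n => path_space (X n)))%type.

(* The homotopy limit of a sequential tower as its mapping microscope: points
   x_n of X n together with paths in X n from x_n to the image of x_(n+1).
   This is the limit of the tower obtained from X by functorially replacing the
   bonding maps by path fibrations; every space being fibrant, it computes the
   derived limit. *)
Definition holim_set (X : tower) : set (holim_ambient X) :=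
  [set p | forall n, (p.2 n : continuousType _ _) zero = p.1 n /\
                     (p.2 n : continuousType _ _) one = bond X n (p.1 n.+1)].

Definition holim (X : tower) : topologicalType := set_type (@holim_set X).

Lemma prod_topology_continuous (I : Type) (K : I -> topologicalType)
    (T : topologicalType) (f : T -> prod_topology K) :
  (forall i, continuous (fun t => f t i)) -> continuous f.
Proof.
move=> cf t; apply/cvg_sup => i.
apply: (@continuous_comp_initial _ _ _ (fun g : (forall i, K i) => g i)
  (f : T -> initial_topology (fun g : (forall i, K i) => g i))).
exact: cf.
Qed.

Lemma prod_topology_proj_continuous (I : Type) (K : I -> topologicalType) i :
  continuous (fun f : prod_topology K => f i).
Proof.
move=> f; have /cvg_sup/(_ i) h : f --> f by apply: cvg_id.
exact: (cvg_trans (cvg_app _ h) (@initial_continuous _ _ _ f)).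
Qed.

Lemma path_space_map_continuous (X Y : topologicalType) (f : continuousType X Y) :
  continuous (fun p : path_space X =>
    (f \o (p : continuousType _ _) : continuousType (unitI R) Y) : path_space Y).
Proof.
apply: continuous_comp_initial => p; apply/compact_open_cvgP.
  exact: (fmap_filter _ (nbhs_filter p)).
move=> K O cK oO fpKO.
have nb : nbhs ((p : continuousType _ _) : {compact-open, unitI R -> X})
    [set g : {compact-open, unitI R -> X} | g @` K `<=` f @^-1` O].
  apply: open_nbhs_nbhs; split.
    apply: compact_open_open => //; apply: open_comp => // x _; exact: cts_fun.
  by move=> _ [k Kk <-]; apply: fpKO; exists k.
have := @initial_continuous (continuousType (unitI R) X)
  {compact-open, unitI R -> X} id p _ nb.
by apply: (@filterS _ (nbhs p)) => q qK _ [k Kk <-]; apply: qK; exists k.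
Qed.

Section HolimMap.
Context (X Y : tower) (f : tower_map X Y).

Definition holim_ambient_map (p : holim_ambient X) : holim_ambient Y :=
  (fun n => f n (p.1 n),
   fun n => (f n \o (p.2 n : continuousType _ _) : continuousType _ _)).

Lemma holim_ambient_map_continuous : continuous holim_ambient_map.
Proof.
move=> p; apply: (@cvg_pair _ _ _ (nbhs p) (nbhs (holim_ambient_map p).1)
  (nbhs (holim_ambient_map p).2) _ _ _
  (fun q => (holim_ambient_map q).1) (fun q => (holim_ambient_map q).2)).
  move: p; apply: prod_topology_continuous => n p /=.
  apply: (@continuous_comp _ _ _ (fun q : holim_ambient X => q.1 n) (f n));
    last exact: cts_fun.
  apply: (@continuous_comp _ _ _ fst (fun g : prod_topology _ => g n)).
    exact: cvg_fst.
  exact: prod_topology_proj_continuous.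
move: p; apply: prod_topology_continuous => n p /=.
apply: (@continuous_comp _ _ _ (fun q : holim_ambient X => q.2 n)
  (fun g : path_space (X n) =>
    (f n \o (g : continuousType _ _) : continuousType _ _) : path_space (Y n)));
  last exact: path_space_map_continuous.
apply: (@continuous_comp _ _ _ snd (fun g : prod_topology _ => g n)).
  exact: cvg_snd.
exact: prod_topology_proj_continuous.
Qed.

Lemma holim_map_subproof (p : holim X) :
  holim_ambient_map (set_val p) \in @holim_set Y.
Proof.
apply/mem_set => n; have [p0 p1] := set_valP p n.
by split=> /=; rewrite ?p0 ?p1 ?level_map_bond.
Qed.

Definition holim_map_fun (p : holim X) : holim Y :=
  exist _ (holim_ambient_map (set_val p)) (holim_map_subproof p).

Lemma holim_map_continuous : continuous holim_map_fun.
Proof.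
apply: continuous_comp_initial => p.
apply: (@continuous_comp _ _ _ (set_val : holim X -> holim_ambient X)
  holim_ambient_map); last exact: holim_ambient_map_continuous.
exact: initial_continuous.
Qed.

HB.instance Definition _ := isContinuous.Build (holim X) (holim Y)
  holim_map_fun holim_map_continuous.

Definition holim_map : continuousType (holim X) (holim Y) := holim_map_fun.

End HolimMap.

Lemma holim_eqP (X : tower) (p q : holim X) :
  (forall n, (set_val p).1 n = (set_val q).1 n) ->
  (forall n, ((set_val p).2 n : continuousType _ _) =1
             ((set_val q).2 n : continuousType _ _)) -> p = q.
Proof.
case: p q => [[p1 p2] pX] [[q1 q2] qX] /= pq1 pq2.
have {pq1}e1 : p1 = q1 by apply: functional_extensionality_dep.
have {pq2}e2 : p2 = q2.
  by apply: functional_extensionality_dep => n; apply/continuousEP/pq2.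
by rewrite -{}e1 -{}e2 in qX *; congr exist; exact: Prop_irrelevance.
Qed.

Program Definition holim_functor : functor Lim Top :=
  @Functor Lim Top holim holim_map _ _.
Next Obligation. by move=> X; apply/continuousEP => p; apply: holim_eqP. Qed.
Next Obligation. by move=> *; apply/continuousEP => p; apply: holim_eqP. Qed.

Lemma holim_proj_continuous (X : tower) n :
  continuous (fun p : holim X => (set_val p).1 n).
Proof.
move=> p; apply: (@continuous_comp _ _ _ (set_val : holim X -> holim_ambient X)
  (fun q => q.1 n)); first exact: initial_continuous.
apply: (@continuous_comp _ _ _ fst (fun g : prod_topology _ => g n)).
  exact: cvg_fst.
exact: prod_topology_proj_continuous.
Qed.

Definition holim_proj (X : tower) n : continuousType (holim X) (X n) :=
  mkcts (@holim_proj_continuous X n).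

End Towers.

(* Main.v *)
Require Import Defs.
From Stdlib Require Import Relations.
From HB Require Import structures.
From mathcomp Require Import all_boot all_order all_algebra generic_quotient.
From mathcomp Require Import all_classical all_reals topology normedtype.
From mathcomp Require Import homotopy ring lra.

(** The projections from the homotopy limit to the levels of the tower are
    n-equivalences ([holim_proj_n_equivalence]), and everything else follows
    from this by two out of three.

    A map of a ball into the microscope is a sequence of maps into the levels,
    joined by homotopies along the bonding maps. Starting from one level N, such
    a sequence is built downwards by extending homotopies and upwards by lifting
    through the bonding maps, always with prescribed boundary values
    ([tower_lift]). For surjectivity on the i-th homotopy group, lifting upwards
    asks for surjectivity of the bonding maps in dimension i <= n. For
    injectivity one extends over a ball of dimension i + 1: injectivity of the
    bonding maps in dimension i gives some extension at the next level, and
    surjectivity in dimension i + 1 corrects it until it fits the previous level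
    ([lifts_extend]). As i + 1 may exceed n, one first moves from level n to
    level n + 1 ([point_homotopic_up]). The homotopy groups of a fixed dimension
    are thus eventually constant along the tower, and their first derived limit
    never comes up.

    Cubes are treated as balls of a sup norm, and the homotopies come from one
    formula, a map on an inner ball surrounded by a shell ([shell]).

    The projections do not commute with the bonding maps, except up to homotopy.
    A strict zigzag between a tower X and the constant tower on its homotopy
    limit runs through the tower of homotopy limits of the tails of X ([tails]),
    each mapped to the previous one by adding a constant path ([prepend]). The
    other zigzag is the single map that sends a point to the sequence of its
    constant paths ([to_holim_const]). *)

Set Implicit Arguments.
Unset Strict Implicit.
Unset Printing Implicit Defensive.
Import Order.TTheory GRing.Theory Num.Theory numFieldNormedType.Exports.
Local Open Scope classical_set_scope.
Local Open Scope ring_scope.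
Local Open Scope quotient_scope.

(** * Continuity of explicit formulas *)

Section Continuity.
Context {S T U : topologicalType}.

Lemma cts_comp (g : T -> U) (f : S -> T) :
  continuous g -> continuous f -> continuous (fun x => g (f x)).
Proof. by move=> cg cf x; apply: continuous_comp; [exact: cf|exact: cg]. Qed.

Lemma cts_pair (f : S -> T) (g : S -> U) :
  continuous f -> continuous g -> continuous (fun x => (f x, g x)).
Proof. by move=> cf cg x; apply: cvg_pair; [exact: cf|exact: cg]. Qed.

Lemma cts_fst (f : S -> T * U) : continuous f -> continuous (fun x => (f x).1).
Proof. by move=> cf x; apply: continuous_comp; [exact: cf|exact: cvg_fst]. Qed.

Lemma cts_snd (f : S -> T * U) : continuous f -> continuous (fun x => (f x).2).
Proof. by move=> cf x; apply: continuous_comp; [exact: cf|exact: cvg_snd]. Qed.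

Lemma cts_cst (y : T) : continuous (fun _ : S => y).
Proof. by move=> x; exact: cvg_cst. Qed.

Lemma cts_id : continuous (fun x : S => x).
Proof. by move=> x; exact: cvg_id. Qed.

(** Continuity of boundary data is only known on a closed set, so that it has to
    be composed with maps into that set. *)
Lemma within_comp (A : set S) (B : set T) (g : T -> U) (f : S -> T) :
  {within A, continuous f} -> {within B, continuous g} ->
  (forall x, A x -> B (f x)) -> {within A, continuous (fun x => g (f x))}.
Proof.
move=> /subspace_continuousP cf /subspace_continuousP cg AB.
apply/subspace_continuousP => x Ax W /(cg _ (AB _ Ax)).
rewrite !nbhs_simpl /within/= => /(cf _ Ax); rewrite !nbhs_simpl /within/=.
by apply: filterS => y WB Ay; exact/WB/AB.
Qed.

Lemma within_eq (A : set S) (f g : S -> T) :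
  (forall x, A x -> f x = g x) ->
  {within A, continuous f} -> {within A, continuous g}.
Proof. by move=> fg; apply: subspace_eq_continuous => x /set_mem; exact: fg. Qed.

Lemma within_pair (A : set S) (f : S -> T) (g : S -> U) :
  {within A, continuous f} -> {within A, continuous g} ->
  {within A, continuous (fun x => (f x, g x))}.
Proof.
move=> /subspace_continuousP cf /subspace_continuousP cg.
apply/subspace_continuousP => x Ax.
by apply: cvg_pair; [exact: cf|exact: cg].
Qed.

(** The pasting lemma on a closed cover of the whole space. *)
Lemma cts_paste (A B : set S) (f : S -> T) : closed A -> closed B ->
  (forall x, A x \/ B x) ->
  {within A, continuous f} -> {within B, continuous f} -> continuous f.
Proof.
move=> cA cB AB fA fB; apply/continuous_subspace_setT.
have <- : A `|` B = setT by apply/seteqP; split=> x // _; exact: AB.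
exact: withinU_continuous.
Qed.

End Continuity.

Section RealContinuity.
Context {R : realType} {S : topologicalType}.

Lemma cts_add (V : normedModType R) (f g : S -> V) :
  continuous f -> continuous g -> continuous (fun x => f x + g x).
Proof. by move=> cf cg x; apply: cvgD; [exact: cf|exact: cg]. Qed.

Lemma cts_opp (V : normedModType R) (f : S -> V) :
  continuous f -> continuous (fun x => - f x).
Proof. by move=> cf x; apply: cvgN; exact: cf. Qed.

Lemma cts_mul (f g : S -> R) :
  continuous f -> continuous g -> continuous (fun x => f x * g x).
Proof. by move=> cf cg x; apply: cvgM; [exact: cf|exact: cg]. Qed.

Lemma cts_scale (V : normedModType R) (f : S -> R) (g : S -> V) :
  continuous f -> continuous g -> continuous (fun x => f x *: g x).
Proof. by move=> cf cg x; apply: cvgZ; [exact: cf|exact: cg]. Qed.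

Lemma cts_norm (V : normedModType R) (f : S -> V) :
  continuous f -> continuous (fun x => `|f x|).
Proof. by move=> cf x; apply: cvg_norm; exact: cf. Qed.

Lemma cts_max (f g : S -> R) :
  continuous f -> continuous g -> continuous (fun x => Num.max (f x) (g x)).
Proof. by move=> cf cg x; apply: continuous_max; [exact: cf|exact: cg]. Qed.

Lemma cts_min (f g : S -> R) :
  continuous f -> continuous g -> continuous (fun x => Num.min (f x) (g x)).
Proof. by move=> cf cg x; apply: continuous_min; [exact: cf|exact: cg]. Qed.

Lemma closed_le_fun (f g : S -> R) :
  continuous f -> continuous g -> closed [set x | f x <= g x].
Proof.
move=> cf cg.
have -> : [set x | f x <= g x] = (fun x => f x - g x) @^-1` [set y | y <= 0].
  by apply/seteqP; split=> x /=; rewrite subr_le0.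
apply: (@preimage_closed _ _ (fun x => f x - g x) [set y | y <= 0]); last exact: closed_le.
by move=> x _; apply: (cts_add cf (cts_opp cg)).
Qed.

End RealContinuity.

(** Proves the continuity of a formula by following its syntax; the continuity
    of the functions that occur in it is looked up among the hypotheses. *)
Ltac cts := repeat first
  [ assumption
  | match goal with
    | |- continuous (fun z_ => z_) => exact: cts_id
    | |- continuous (fun _ => ?c) => exact: cts_cst
    | |- continuous Num.norm => exact: (cts_norm cts_id)
    | |- continuous fst => exact: (cts_fst cts_id)
    | |- continuous snd => exact: (cts_snd cts_id)
    | |- continuous (fun z_ => (@?f z_, @?g z_)) => apply: (@cts_pair _ _ _ f g)
    | |- continuous (fun z_ => fst (@?f z_)) => apply: (@cts_fst _ _ _ f)
    | |- continuous (fun z_ => snd (@?f z_)) => apply: (@cts_snd _ _ _ f)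
    | |- continuous (fun z_ => @?f z_ + @?g z_) => apply: (@cts_add _ _ _ f g)
    | |- continuous (fun z_ => - @?f z_) => apply: (@cts_opp _ _ _ f)
    | |- continuous (fun z_ => @?f z_ * @?g z_) => apply: (@cts_mul _ _ f g)
    | |- continuous (fun z_ => @?f z_ *: @?g z_) => apply: (@cts_scale _ _ _ f g)
    | |- continuous (fun z_ => `| @?f z_ |) => apply: (@cts_norm _ _ _ f)
    | |- continuous (fun z_ => Num.max (@?f z_) (@?g z_)) => apply: (@cts_max _ _ f g)
    | |- continuous (fun z_ => Num.min (@?f z_) (@?g z_)) => apply: (@cts_min _ _ f g)
    | H : continuous ?h |- continuous (fun z_ => ?h (@?f z_)) =>
        apply: (@cts_comp _ _ _ h f H)
    end ].

(** * Extending and lifting maps of a ball *)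

Definition sphere {R : realType} (E : normedModType R) : set E :=
  [set w | `|w| = 1].
Arguments sphere {R} E.

Definition sphere_times {R : realType} (E : normedModType R) (T : Type) :
  set (E * T) := [set q | sphere E q.1].
Arguments sphere_times {R} E T.

Section Shell.
Context {R : realType} (E : normedModType R) (T Y : topologicalType).

(** The map that shows W, shrunk radially, on the ball of radius
    1 / (1 + mu t), and G on the remaining shell, whose points are recorded by
    their direction, by t, and by a depth that grows from 0 on the inner sphere
    to mu t on the unit sphere. Base point changes, concatenations with
    prescribed boundary values and radial contractions are all of this form. *)
Definition shell (mu : T -> R) (W : E * T -> Y) (G : E * (T * R) -> Y)
    (p : E * T) : Y :=
  if (1 + mu p.2) * `|p.1| <= 1 then W ((1 + mu p.2) *: p.1, p.2)
  else G (`|p.1|^-1 *: p.1, (p.2, (1 + mu p.2) * `|p.1| - 1)).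

Context (mu : T -> R) (W : E * T -> Y) (G : E * (T * R) -> Y).

Lemma shell_sphere : (forall t, 0 <= mu t) ->
  (forall w t, sphere E w -> G (w, (t, 0)) = W (w, t)) ->
  forall w t, sphere E w -> shell mu W G (w, t) = G (w, (t, mu t)).
Proof.
move=> mu0 GW w t; rewrite /sphere /= /shell /= => w1.
rewrite w1 mulr1 invr1 scale1r addrAC subrr add0r; case: ifP => // h.
have -> : mu t = 0 by apply/le_anti; rewrite mu0 andbT; move: h; rewrite gerDl.
by rewrite addr0 scale1r GW.
Qed.

Lemma shell_ball w t : mu t = 0 -> `|w| <= 1 -> shell mu W G (w, t) = W (w, t).
Proof. by move=> mut w1; rewrite /shell /= mut addr0 mul1r w1 scale1r. Qed.

Lemma shell_continuous : continuous mu -> continuous W ->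
  {within sphere_times E (T * R)%type, continuous G} ->
  (forall w t, sphere E w -> G (w, (t, 0)) = W (w, t)) ->
  continuous (shell mu W G).
Proof.
move=> cmu cW cG GW.
pose A := [set p : E * T | (1 + mu p.2) * `|p.1| <= 1].
pose B := [set p : E * T | 1 <= (1 + mu p.2) * `|p.1|].
have B0 p : B p -> p.1 != 0.
  by apply: contraTneq => ->; rewrite normr0 mulr0 ler10.
apply: (@cts_paste _ _ A B).
- by apply: closed_le_fun => //; cts.
- by apply: closed_le_fun => //; cts.
- by move=> p; apply/orP; rewrite /A /B /= le_total.
- apply: (@within_eq _ _ A (fun p => W ((1 + mu p.2) *: p.1, p.2))).
    by move=> p Ap; rewrite /shell /= ifT.
  by apply: continuous_subspaceT; cts.
- apply: (@within_eq _ _ B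
    (fun p => G (`|p.1|^-1 *: p.1, (p.2, (1 + mu p.2) * `|p.1| - 1)))).
    move=> p Bp; rewrite /shell /=; case: ifP => // Ap.
    have e1 : (1 + mu p.2) * `|p.1| = 1 by apply/le_anti; rewrite Ap Bp.
    have p0 : `|p.1| != 0 by rewrite normr_eq0 B0.
    have e2 : `|p.1|^-1 = 1 + mu p.2.
      by apply: (mulIf p0); rewrite mulVf// e1.
    rewrite e1 subrr GW e2//.
    by rewrite /sphere /= normrZ -e2 normfV normr_id mulVf.
  apply: (@within_comp _ _ _ B (sphere_times E (T * R)%type) G).
  + apply: within_pair; last by apply: continuous_subspaceT; cts.
    apply: continuous_in_subspaceT => p /set_mem Bp.
    have n0 : `|p.1| != 0 by rewrite normr_eq0 B0.
    apply: cvgZ; last exact: cvg_fst.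
    by apply: cvgV => //; apply: cvg_norm; exact: cvg_fst.
  + exact: cG.
  + move=> p Bp; rewrite /sphere_times /sphere /= normrZ normfV normr_id mulVf//.
    by rewrite normr_eq0 B0.
Qed.

End Shell.

Section Extension.
Context {R : realType} (E : normedModType R) (Y : topologicalType).

Definition clip (t : R) : R := Num.max 0 (Num.min 1 t).

Lemma clip_ge0 t : 0 <= clip t. Proof. by rewrite le_max lexx. Qed.

Lemma clip_le1 t : clip t <= 1.
Proof. by rewrite ge_max ler01 ge_min lexx. Qed.

Lemma clip_id t : 0 <= t <= 1 -> clip t = t.
Proof. by move=> /andP[t0 t1]; rewrite /clip (min_idPr t1) (max_idPr t0). Qed.

Lemma clip0 : clip 0 = 0. Proof. by rewrite clip_id// lexx ler01. Qed.

Lemma clip1 : clip 1 = 1. Proof. by rewrite clip_id// lexx ler01. Qed.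

Lemma clip_continuous : continuous clip.
Proof. by rewrite /clip; cts. Qed.

(** The radial retraction onto the closed unit ball. *)
Definition retract (w : E) : E := (Num.max 1 `|w|)^-1 *: w.

Lemma retract_id w : `|w| <= 1 -> retract w = w.
Proof. by move=> w1; rewrite /retract (max_idPl w1) invr1 scale1r. Qed.

Lemma retract_continuous : continuous retract.
Proof.
move=> w; apply: cvgZ; last exact: cvg_id.
apply: cvgV; first by rewrite gt_eqF// lt_max ltr01.
by apply: (_ : continuous (fun x : E => Num.max 1 `|x|)); cts.
Qed.

Lemma retract_le1 w : `|retract w| <= 1.
Proof.
have m0 : 0 < Num.max 1 `|w| by rewrite lt_max ltr01.
rewrite /retract normrZ gtr0_norm ?invr_gt0// mulrC ler_pdivrMr// mul1r.
by rewrite le_max lexx orbT.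
Qed.

(** A collar of thickness growing with t absorbs the given homotopy d of the
    boundary values: this is a shell with mu t = t. *)
Lemma homotopy_extension (g : E -> Y) (d : E * R -> Y) :
  continuous g -> {within sphere_times E R, continuous d} ->
  (forall w, sphere E w -> d (w, 0) = g w) ->
  exists K : E * R -> Y, [/\ continuous K,
    forall w, `|w| <= 1 -> K (w, 0) = g w &
    forall w t, sphere E w -> 0 <= t <= 1 -> K (w, t) = d (w, t)].
Proof.
move=> cg cd dg; have cc := clip_continuous.
pose W (p : E * R) := g p.1; pose G (q : E * (R * R)) := d (q.1, q.2.2).
have GW w t : sphere E w -> G (w, (t, 0)) = W (w, t).
  by move=> w1; rewrite /G /W /= dg.
exists (shell clip W G); split.
- apply: shell_continuous => //; first by rewrite /W; cts.
  apply: (@within_comp _ _ _ _ (sphere_times E R) d) => //.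
  by apply: continuous_subspaceT; cts.
- by move=> w w1; rewrite shell_ball// clip0.
- move=> w t w1 t01; rewrite shell_sphere//; last exact: clip_ge0.
  by rewrite /G /= clip_id.
Qed.

(** The concatenation of K and L runs through d at double speed on the sphere
    and then stops. At time t it has reached d (w, min (2 t) 1), and a shell of
    depth min (2 t) 1 - t walks back from there to d (w, t), so that the
    boundary values become exactly d. The depth vanishes at both ends, where
    nothing changes. *)
Lemma homotopy_concat (K L d : E * R -> Y) :
  continuous K -> continuous L -> {within sphere_times E R, continuous d} ->
  (forall w, `|w| <= 1 -> K (w, 1) = L (w, 0)) ->
  (forall w t, sphere E w -> 0 <= t <= 1 -> K (w, t) = d (w, t)) ->
  (forall w t, sphere E w -> 0 <= t <= 1 -> L (w, t) = d (w, 1)) ->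
  exists M : E * R -> Y, [/\ continuous M,
    forall w, `|w| <= 1 -> M (w, 0) = K (w, 0),
    forall w, `|w| <= 1 -> M (w, 1) = L (w, 1) &
    forall w t, sphere E w -> 0 <= t <= 1 -> M (w, t) = d (w, t)].
Proof.
move=> cK cL cd KL Kd Ld.
have cc := clip_continuous; have cr := retract_continuous.
pose W (p : E * R) : Y := if p.2 <= 2^-1 then K (retract p.1, clip (2 * p.2))
  else L (retract p.1, clip (2 * p.2 - 1)).
have cW : continuous W.
  apply: (@cts_paste _ _ [set p : E * R | p.2 <= 2^-1]
    [set p : E * R | 2^-1 <= p.2]).
  - by apply: closed_le_fun; cts.
  - by apply: closed_le_fun; cts.
  - by move=> p; apply/orP; rewrite /= le_total.
  - apply: (@within_eq (E * R)%type Y _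
      (fun p => K (retract p.1, clip (2 * p.2)))).
      by move=> p /= p2; rewrite /W p2.
    by apply: continuous_subspaceT; cts.
  - apply: (@within_eq (E * R)%type Y _
      (fun p => L (retract p.1, clip (2 * p.2 - 1)))).
      move=> p /= p2; rewrite /W; case: ifP => // p2'.
      have -> : p.2 = 2^-1 by apply/le_anti; rewrite p2 p2'.
      rewrite divff ?pnatr_eq0// subrr clip0 clip1.
      by rewrite KL// retract_le1.
    by apply: continuous_subspaceT; cts.
pose th (s : R) : R := Num.min (2 * clip s) 1.
pose mu (s : R) : R := th s - clip s.
have cth : continuous th by rewrite /th; cts.
have cmu : continuous mu by rewrite /mu; cts.
have mu0 s : 0 <= mu s.
  rewrite subr_ge0 le_min clip_le1 andbT.
  by have := clip_ge0 s; lra.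
pose W' (p : E * R) := W (p.1, clip p.2).
have cW' : continuous W' by rewrite /W'; cts.
pose G (q : E * (R * R)) := d (q.1, th q.2.1 - q.2.2).
have GW w t : sphere E w -> G (w, (t, 0)) = W' (w, t).
  move=> w1; rewrite /G /W' /W /= subr0.
  have wl : `|w| <= 1 by rewrite w1.
  have := clip_ge0 t; have := clip_le1 t; set u := clip t => u1 u0.
  rewrite retract_id//; case: ifPn => [h|].
    by rewrite clip_id ?Kd /th -/u ?(min_idPl _)//; lra.
  rewrite -ltNge => h; rewrite Ld// ?clip_ge0 ?clip_le1//.
  by rewrite /th -/u (min_idPr _)//; lra.
exists (shell mu W' G); split.
- apply: shell_continuous => //.
  apply: (@within_comp _ _ _ _ (sphere_times E R) d) => //.
  by apply: continuous_subspaceT; cts.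
- move=> w w1; rewrite shell_ball//; last first.
    by rewrite /mu /th clip0 mulr0 subr0 (min_idPl _)// ler01.
  rewrite /W' /W /= clip0 ifT ?invr_ge0//.
  by rewrite retract_id// mulr0 clip0.
- move=> w w1; rewrite shell_ball//; last first.
    by rewrite /mu /th clip1 mulr1 (min_idPr _) ?subrr// ler1n.
  rewrite /W' /W /= clip1 ifF; last by apply/negbTE; rewrite -ltNge; lra.
  by rewrite retract_id// mulr1 -[2]/(1 + 1) addrK clip1.
- move=> w t w1 t01; rewrite shell_sphere// /G /= /mu.
  by rewrite opprB addrC subrK clip_id.
Qed.

(** Homotopy relative to the unit sphere. Only the values on the closed unit
    ball matter; F and G are total to keep the formulas simple. *)
Definition ball_homotopic (F G : E -> Y) : Prop :=
  exists h : E * R -> Y, [/\ continuous h,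
    forall w, `|w| <= 1 -> h (w, 0) = F w,
    forall w, `|w| <= 1 -> h (w, 1) = G w &
    forall w t, sphere E w -> 0 <= t <= 1 -> h (w, t) = F w].

Lemma ball_homotopic_trans (F G H : E -> Y) : continuous F ->
  ball_homotopic F G -> ball_homotopic G H -> ball_homotopic F H.
Proof.
move=> cF [h [ch h0 h1 hs]] [k [ck k0 k1 ks]].
have FG w : sphere E w -> F w = G w.
  by move=> w1; rewrite -(hs w 1) ?ler01 ?lexx// h1// w1.
have [||||M [cM M0 M1 Ms]] :=
  @homotopy_concat h k (fun p => F p.1) ch ck.
- by apply: continuous_subspaceT; cts.
- by move=> w w1; rewrite h1// k0.
- exact: hs.
- by move=> w t w1 t01; rewrite ks// -FG.
exists M; split=> // w w1; first by rewrite M0// h0.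
by rewrite M1// k1.
Qed.

End Extension.
Arguments retract {R E}.
Arguments clip {R}.

Section Lifting.
Context {R : realType} (E : normedModType R) (Z Y : topologicalType).
Implicit Types (f : Z -> Y) (phi : E -> Z).

(** Every extension over the ball of the boundary values f phi is, relative to
    the sphere, homotopic to f g for an extension g of phi. For phi constant
    and E of dimension n this is surjectivity on the n-th homotopy group. *)
Definition lifts f phi : Prop := forall c : E -> Y, continuous c ->
  (forall w, sphere E w -> c w = f (phi w)) ->
  exists g : E -> Z, [/\ continuous g, forall w, sphere E w -> g w = phi w &
    ball_homotopic c (f \o g)].

(** Surjectivity at the single base point h 0 gives lifting against the
    boundary values of h, because h contracts them to h 0. Glue c to f h along
    their common boundary: this is a map e0 of the ball that is constantly
    f (h 0) on the sphere, namely c inside and f h read inwards in the shell.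
    Lift e0 to D, and let g be D inside and h read outwards in the shell. Then
    f g is homotopic to e0 followed by f h, and the two opposite radial runs
    through f h cancel, which leaves c. *)
Lemma lifts_extend f (h : E -> Z) :
  continuous f -> continuous h -> lifts f (fun=> h 0) -> lifts f h.
Proof.
move=> cf ch lf c cc c_h.
pose one_ (_ : R) : R := 1.
have one0 t : 0 <= one_ t by exact: ler01.
have c1 : continuous one_ by rewrite /one_; cts.
pose G1 (q : E * (R * R)) := f (h ((1 - q.2.2) *: q.1)).
have cG1 : continuous G1 by rewrite /G1; cts.
pose c' (p : E * R) := c p.1.
have cc' : continuous c' by rewrite /c'; cts.
have cG1c w t : sphere E w -> G1 (w, (t, 0)) = c' (w, t).
  by move=> w1; rewrite /G1 /c' /= subr0 scale1r c_h.
pose e0 w := shell one_ c' G1 (w, 0).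
have ce : continuous (shell one_ c' G1).
  by apply: shell_continuous => //; exact: continuous_subspaceT.
have ce0 : continuous e0 by rewrite /e0; cts.
have [|D [cD D0 [Q [cQ Q0 Q1 Qs]]]] := lf e0 ce0.
  by move=> w w1; rewrite /e0 shell_sphere// /G1 /= subrr scale0r.
have c_e0 w : sphere E w -> e0 w = f (h 0).
  by move=> w1; rewrite /e0 shell_sphere// /G1 /= subrr scale0r.
pose Gh (q : E * (R * R)) := h (q.2.2 *: q.1).
have cGh : continuous Gh by rewrite /Gh; cts.
pose D' (p : E * R) := D p.1.
have cD' : continuous D' by rewrite /D'; cts.
have GhD w t : sphere E w -> Gh (w, (t, 0)) = D' (w, t).
  by move=> w1; rewrite /Gh /D' /= scale0r D0.
pose g w := shell one_ D' Gh (w, 0).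
have cg' : continuous (shell one_ D' Gh).
  by apply: shell_continuous => //; exact: continuous_subspaceT.
exists g; split.
- by rewrite /g; cts.
- by move=> w w1; rewrite /g shell_sphere// /Gh /= scale1r.
pose Gfh (q : E * (R * R)) := f (Gh q).
have cGfh : continuous Gfh by rewrite /Gfh; cts.
(* g1 is f g with e0 in place of f D *)
pose g1 w := shell one_ (fun p => e0 p.1) Gfh (w, 0).
apply: (@ball_homotopic_trans _ _ _ c g1) => //.
  (* at time t both radial runs are cut off at the radius 1 - t *)
  have ck := @clip_continuous R.
  pose G2 (q : E * (R * R)) := f (h ((1 - clip q.2.1 + q.2.2) *: q.1)).
  have cG2 : continuous G2 by rewrite /G2; cts.
  pose A := shell clip c' G1.
  have cA : continuous A.
    apply: shell_continuous => //; first exact: continuous_subspaceT.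
  have G2A w t : sphere E w -> G2 (w, (t, 0)) = A (w, t).
    move=> w1; rewrite /A shell_sphere//; last exact: clip_ge0.
    by rewrite /G2 /G1 /= addr0.
  exists (shell clip A G2); split.
  - by apply: shell_continuous => //; exact: continuous_subspaceT.
  - by move=> w w1; rewrite shell_ball ?clip0// /A shell_ball ?clip0.
  - move=> w w1; rewrite /g1 /e0 /A /shell /= clip1 /one_ /G2 /Gfh /Gh /G1 /=.
    by rewrite clip1 subrr add0r.
  - move=> w t w1 t01; rewrite shell_sphere//; last exact: clip_ge0.
    by rewrite /G2 /= subrK scale1r c_h.
have GfhQ w t : sphere E w -> Gfh (w, (t, 0)) = Q (w, clip t).
  move=> w1; rewrite Qs// ?clip_ge0 ?clip_le1// c_e0//.
  by rewrite /Gfh /Gh /= scale0r.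
pose Q' (p : E * R) := Q (p.1, clip p.2).
have ck := @clip_continuous R.
have cQ' : continuous Q' by rewrite /Q'; cts.
have inner (w : E) : (1 + 1) * `|w| <= 1 :> R -> `|(1 + 1) *: w| <= 1 :> R.
  by rewrite normrZ ger0_norm ?addr_ge0.
exists (shell one_ Q' Gfh); split.
- by apply: shell_continuous => //; exact: continuous_subspaceT.
- move=> w w1; rewrite /g1 /shell /=; case: ifP => // /inner h1.
  by rewrite /Q' /= clip0 Q0.
- move=> w w1; rewrite /g /shell /=; case: ifP => // /inner h1.
  by rewrite /Q' /= clip1 Q1.
- move=> w t w1 t01; rewrite shell_sphere// /g1 shell_sphere// => v s v1.
  by rewrite /Gfh /Gh /= scale0r c_e0.
Qed.

End Lifting.

(** * Maps into the homotopy limit *)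

Section PathEvaluation.
Context {R : realType}.

Lemma unitI_compact : compact [set: unitI R].
Proof.
have -> : [set: unitI R] = clamp @` [set` `[0%R : R, 1%R]].
  apply/seteqP; split=> // s _; exists (uval s) => /=.
    by rewrite in_itv; exact: uval_itv.
  by apply: uval_inj; rewrite uval_clamp// uval_itv.
apply: continuous_compact; last exact: segment_compact.
by apply: continuous_subspaceT; exact: clamp_continuous.
Qed.

Lemma unitI_hausdorff : hausdorff_space (unitI R).
Proof.
move=> s t st; apply: uval_inj; apply: (@Rhausdorff R) => A B As Bt.
have [u [uA uB]] := st _ _ (@uval_continuous R s _ As) (@uval_continuous R t _ Bt).
by exists (uval u).
Qed.

Lemma path_eval_continuous (X : topologicalType) :
  continuous (fun q : path_space R X * unitI R =>
    (q.1 : continuousType _ _) q.2).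
Proof.
have lc : locally_compact [set: unitI R].
  move=> s _; exists setT; first exact: filterT.
  by split; [exact: unitI_compact|exact: closedT].
have reg : regular_space (unitI R).
  by move=> s; apply: (compact_regular unitI_hausdorff unitI_compact filterT).
pose ev (p : path_space R X) (s : unitI R) := (p : continuousType _ _) s.
have -> : (fun q => (q.1 : continuousType _ _) q.2) = uncurry ev.
  by apply/funext => -[].
apply: (@continuous_uncurry_regular (path_space R X) (unitI R) X ev lc reg).
  exact: (@initial_continuous _ {compact-open, unitI R -> X}).
by move=> p; exact: cts_fun.
Qed.

End PathEvaluation.

Section Microscope.
Context {R : realType} (X : tower R).

Definition point_at (n : nat) (p : holim X) : X n := (set_val p).1 n.

Definition path_at (n : nat) (p : holim X) (t : R) : X n :=
  ((set_val p).2 n : continuousType _ _) (clamp t).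

Lemma path_at0 n p : path_at n p 0 = point_at n p.
Proof. by have [] := set_valP p n. Qed.

Lemma path_at1 n p : path_at n p 1 = bond X n (point_at n.+1 p).
Proof. by have [] := set_valP p n. Qed.

Lemma point_at_continuous n : continuous (point_at n).
Proof. exact: holim_proj_continuous. Qed.

Lemma path_at_continuous n :
  continuous (fun q : holim X * R => path_at n q.1 q.2).
Proof.
have cv : continuous (fun p : holim X => (set_val p).2 n).
  move=> p; apply: (@continuous_comp _ _ _
    (set_val : holim X -> holim_ambient X) (fun q => q.2 n)).
    exact: initial_continuous.
  apply: (@continuous_comp _ _ _ snd (fun g : prod_topology _ => g n)).
    exact: cvg_snd.
  exact: prod_topology_proj_continuous.
apply: (@cts_comp _ _ _ _ (fun q : holim X * R => ((set_val q.1).2 n, clamp q.2))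
  (@path_eval_continuous R (X n))).
apply: cts_pair; first exact: (cts_comp cv (cts_fst cts_id)).
exact: (cts_comp (@clamp_continuous R) (cts_snd cts_id)).
Qed.

(** The points are the starting points of the paths. *)
Lemma holim_ext (p q : holim X) :
  (forall n t, 0 <= t <= 1 -> path_at n p t = path_at n q t) -> p = q.
Proof.
move=> pq; apply: holim_eqP => n.
  by have := pq n 0; rewrite !path_at0; apply; rewrite lexx ler01.
move=> s; have := pq n (uval s) (uval_itv s); rewrite /path_at.
suff -> : clamp (uval s) = s by [].
by apply: uval_inj; rewrite uval_clamp// uval_itv.
Qed.

(** A map into the homotopy limit amounts to one homotopy K n into each X n, the
    end of K n being the image of the start of K n.+1. *)
Section Build.
Context (T : topologicalType) (K : forall n, T * R -> X n).
Hypothesis cK : forall n, continuous (K n).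
Hypothesis K1 : forall n v, K n (v, 1) = bond X n (K n.+1 (v, 0)).

Lemma build_path_continuous n v :
  continuous (fun s : unitI R => K n (v, uval s)).
Proof.
have cu := @uval_continuous R; have ck := @cK n; cts.
Qed.

Definition build_ambient (v : T) : holim_ambient X :=
  (fun n => K n (v, 0), 
   fun n => (mkcts (@build_path_continuous n v) : continuousType (unitI R) (X n))).

Lemma build_subproof v : build_ambient v \in @holim_set R X.
Proof.
by apply/mem_set => n; rewrite /= /mkcts uval0 uval1 K1.
Qed.

Definition build (v : T) : holim X :=
  exist _ (build_ambient v) (build_subproof v).

Lemma build_path v n t : path_at n (build v) t = K n (v, clip t).
Proof. by []. Qed.

Lemma build_point v n : point_at n (build v) = K n (v, 0).
Proof. by []. Qed.

Lemma build_continuous : continuous build.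
Proof.
apply: continuous_comp_initial => v.
have c1 : continuous (fun v => (build_ambient v).1).
  by apply: prod_topology_continuous => n; have ck := @cK n; rewrite /=; cts.
have c2 : continuous (fun v => (build_ambient v).2).
  apply: prod_topology_continuous => n /=.
  apply: continuous_comp_initial.
  have cu := @uval_continuous R; have ck := @cK n.
  have /continuous_curry_fun : continuous
    (fun q : T * unitI R => K n (q.1, uval q.2)) by cts.
  by [].
exact: (cts_pair c1 c2).
Qed.

End Build.
End Microscope.

(** * Lifting along a tower *)

(** A term in the middle of a sequence determines the others, one at a time in
    both directions. *)
Lemma dependent_choice_from (P : nat -> Type)
    (link : forall n, P n -> P n.+1 -> Prop) (N : nat) (x : P N) :
  (forall n (a : P n), (N <= n)%N -> exists b, link n a b) ->
  (forall n (b : P n.+1), (n < N)%N -> exists a, link n a b) ->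
  exists F : forall n, P n, F N = x /\ forall n, link n (F n) (F n.+1).
Proof.
elim: N P link x => [|N IH] P link x up down.
  pose F := fix F n : P n := match n with
    | 0 => x
    | n'.+1 => projT1 (cid (up n' (F n') (leq0n n')))
    end.
  exists F; split=> // n; exact: projT2 (cid (up n (F n) (leq0n n))).
have [n a Nn|n b nN|F [FN Fl]] :=
  IH (fun n => P n.+1) (fun n => @link n.+1) x.
- exact: up.
- exact: down.
have [x0 x0l] := down 0%N (F 0%N) (ltn0Sn N).
by exists (fun n => if n is n'.+1 then F n' else x0); split=> // -[|n].
Qed.

Section TowerLifting.
Context {R : realType} (X : tower R) (E : normedModType R).
Context (phi : E -> holim X) (cphi : {within sphere E, continuous phi}).

Definition boundary_path n (q : E * R) : X n := path_at n (phi q.1) q.2.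

Lemma boundary_path_continuous n :
  {within sphere_times E R, continuous (boundary_path n)}.
Proof.
apply: (@within_comp _ _ _ _ setT (fun q => path_at n q.1 q.2)
  (fun q => (phi q.1, q.2))) => //.
  apply: within_pair; last by apply: continuous_subspaceT; cts.
  apply: (@within_comp _ _ _ _ (sphere E) phi) => //.
  by apply: continuous_subspaceT; cts.
by apply: continuous_subspaceT; exact: path_at_continuous.
Qed.

(** a is a possible n-th component, on the ball, of an extension of phi. *)
Definition extends_point n (a : E -> X n) : Prop :=
  continuous a /\ forall w, sphere E w -> a w = point_at n (phi w).

(** K is a possible n-th path component of an extension of phi with point
    components a and b. *)
Definition linked n (a : E -> X n) (b : E -> X n.+1) : Prop :=
  exists K : E * R -> X n, [/\ continuous K,
    forall w, `|w| <= 1 -> K (w, 0) = a w,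
    forall w, `|w| <= 1 -> K (w, 1) = bond X n (b w) &
    forall w t, sphere E w -> 0 <= t <= 1 -> K (w, t) = boundary_path n (w, t)].

Lemma transport n (a : E -> X n) : extends_point a ->
  exists K : E * R -> X n, [/\ continuous K,
    forall w, `|w| <= 1 -> K (w, 0) = a w &
    forall w t, sphere E w -> 0 <= t <= 1 -> K (w, t) = boundary_path n (w, t)].
Proof.
move=> [ca aphi]; apply: homotopy_extension => //.
  exact: boundary_path_continuous.
by move=> w w1; rewrite /boundary_path path_at0 aphi.
Qed.

(** Move a along the boundary paths to a map c with the boundary values of
    bond b, lift c to b up to a homotopy relative to the sphere, and concatenate
    the two homotopies. *)
Lemma link_up n (a : E -> X n) : extends_point a ->
  lifts (bond X n) (fun w => point_at n.+1 (phi w)) ->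
  exists2 b, extends_point b & linked a b.
Proof.
move=> /transport[K [cK K0 Kd]] lb.
have in01 : (0 : R) <= 1 <= (1 : R) by rewrite ler01 lexx.
have [||b [cb bphi [L [cL L0 L1 Ls]]]] := lb (fun w => K (w, 1)).
- by cts.
- by move=> w w1; rewrite Kd// /boundary_path path_at1.
exists b => //.
have [|||M [cM M0 M1 Ms]] := homotopy_concat cK cL (@boundary_path_continuous n).
- by move=> w w1; rewrite L0.
- by move=> w t w1 t01; rewrite Kd.
- by move=> w t w1 t01; rewrite Ls// Kd.
exists M; split=> // w w1; first by rewrite M0// K0.
by rewrite M1// L1.
Qed.

(** Downwards nothing has to be lifted: a is bond b, moved backwards along the
    boundary paths. *)
Lemma link_down n (b : E -> X n.+1) : extends_point b ->
  exists2 a, extends_point a & linked a b.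
Proof.
move=> [cb bphi]; have cB : continuous (bond X n) by exact: cts_fun.
pose d (q : E * R) := boundary_path n (q.1, 1 - q.2).
have [|||K [cK K0 Kd]] := @homotopy_extension _ E _ (fun w => bond X n (b w)) d.
- by cts.
- apply: (@within_comp _ _ _ _ (sphere_times E R) (boundary_path n)) => //.
    by apply: continuous_subspaceT; cts.
  exact: boundary_path_continuous.
- by move=> w w1; rewrite /d /= subr0 /boundary_path path_at1 bphi.
exists (fun w => K (w, 1)).
  split; first by cts.
  move=> w w1; rewrite Kd ?ler01 ?lexx// /d /= subrr.
  by rewrite /boundary_path path_at0.
exists (fun q => K (q.1, 1 - q.2)); split=> //=.
- by cts.
- by move=> w w1; rewrite subr0.
- by move=> w w1; rewrite subrr K0.
- by move=> w t w1 t01; rewrite Kd /d//= ?subKr//; lra.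
Qed.

(** The obstruction to extending phi over the ball is met level by level; above
    level N it is killed by the lifting property of the bonding maps. *)
Lemma tower_lift N (a : E -> X N) : extends_point a ->
  (forall n, (N <= n)%N ->
    lifts (bond X n) (fun w => point_at n.+1 (phi w))) ->
  exists Phi : E -> holim X, [/\ continuous Phi,
    forall w, sphere E w -> Phi w = phi w &
    forall w, `|w| <= 1 -> point_at N (Phi w) = a w].
Proof.
move=> aphi lb.
have [||F [FN Fl]] := @dependent_choice_from
  (fun n => {b : E -> X n | extends_point b})
  (fun n b c => linked (sval b) (sval c)) N (exist _ a aphi).
- move=> n [b bphi] Nn; have [c cphi' bc] := link_up bphi (lb n Nn).
  by exists (exist _ c cphi').
- move=> n [b bphi] _; have [c cphi' cb] := link_down bphi.
  by exists (exist _ c cphi').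
have [K /all_and4[cK K0 K1 Kd]] : exists K : forall n, E * R -> X n,
    forall n, [/\ continuous (K n),
    forall w, `|w| <= 1 -> K n (w, 0) = sval (F n) w,
    forall w, `|w| <= 1 -> K n (w, 1) = bond X n (sval (F n.+1) w) &
    forall w t, sphere E w -> 0 <= t <= 1 ->
      K n (w, t) = boundary_path n (w, t)].
  by exists (fun n => projT1 (cid (Fl n))) => n; exact: projT2 (cid (Fl n)).
pose K' n (q : E * R) := K n (retract q.1, clip q.2).
have cK' n : continuous (K' n).
  have ck := @cK n; have cr := @retract_continuous _ E.
  by have cc := @clip_continuous R; rewrite /K'; cts.
have K'1 n w : K' n (w, 1) = bond X n (K' n.+1 (w, 0)).
  by rewrite /K' /= clip0 clip1 K1 ?K0// retract_le1.
exists (build cK' K'1); split.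
- exact: build_continuous.
- move=> w w1; apply: holim_ext => n t t01.
  rewrite build_path /K' /= retract_id; last by rewrite w1.
  by rewrite clip_id// clip_id// Kd.
- by move=> w w1; rewrite build_point /K' /= clip0 retract_id// K0// FN.
Qed.

End TowerLifting.

(** * The cube as the ball of a sup norm *)

Section RowVectors.
Context {R : realType}.

Lemma row_continuous (T : topologicalType) n (F : T -> 'I_n -> R) :
  (forall j, continuous (F^~ j)) -> continuous (fun t => \row_j F t j).
Proof.
move=> cF t A [P Pt PA]; rewrite nbhs_simpl /=.
have : \forall u \near t, forall j, P ord0 j (F u j).
  have /filter_forall : forall j, \forall u \near t, P ord0 j (F u j).
    by move=> j; apply: (cF j t); have := Pt ord0 j; rewrite mxE.
  by [].
by apply: filterS => u uP; apply: PA => i j; rewrite mxE ord1.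
Qed.

Lemma row_norm_le n (v : 'rV[R]_n) (r : R) : 0 <= r ->
  (`|v| <= r) <-> (forall j, `|v ord0 j| <= r).
Proof.
have e : `|v| = \big[Num.max/0]_ij `|v ij.1 ij.2| := mx_normrE v.
move=> r0; rewrite e; split.
  by move=> /bigmax_leP[_ h] j; exact: (h (ord0, j)).
by move=> h; apply/bigmax_leP; split=> // -[i j] _; rewrite /= ord1.
Qed.

Lemma row_norm_coord n (v : 'rV[R]_n) j : `|v ord0 j| <= `|v|.
Proof. by move: j; apply/row_norm_le. Qed.

Lemma row_norm_attained n (v : 'rV[R]_n) : `|v| != 0 ->
  exists j, `|v| = `|v ord0 j|.
Proof. by move=> /mx_norm_neq0[[i j]] /=; rewrite ord1; exists j. Qed.

Lemma sphere_row0 (v : 'rV[R]_0) : ~ sphere _ v.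
Proof.
rewrite /sphere /= => v1; have := oner_neq0 R.
by rewrite -v1 => /row_norm_attained[[]].
Qed.

End RowVectors.

Section CubeBall.
Context {R : realType} (n : nat).

Definition to_cube (v : 'rV[R]_n) : cube R n :=
  fun j => clamp ((1 + v ord0 j) / 2).

Definition of_cube (k : cube R n) : 'rV[R]_n :=
  \row_j (2 * uval (k j) - 1).

Lemma to_cube_continuous : continuous to_cube.
Proof.
apply: prod_topology_continuous => j; rewrite /to_cube.
by have cj := @coord_continuous R 1 n ord0 j; have cc := @clamp_continuous R; cts.
Qed.

Lemma of_cube_continuous : continuous of_cube.
Proof.
apply: row_continuous => j; have cu := @uval_continuous R.
have cj := @prod_topology_proj_continuous _ (fun _ : 'I_n => unitI R) j.
by cts.
Qed.

Lemma of_cubeK : cancel of_cube to_cube.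
Proof.
move=> k; apply/funext => j; apply: uval_inj; rewrite /to_cube mxE.
by have := uval_itv (k j); set u := uval _ => u01; rewrite uval_clamp; lra.
Qed.

Lemma to_cubeK (v : 'rV[R]_n) : `|v| <= 1 -> of_cube (to_cube v) = v.
Proof.
move=> v1; apply/rowP => j; rewrite mxE.
have := le_trans (row_norm_coord v j) v1; rewrite ler_norml => /andP[a b].
by rewrite uval_clamp; lra.
Qed.

Lemma of_cube_le1 k : `|of_cube k| <= 1.
Proof.
apply/row_norm_le => // j; rewrite mxE ler_norml.
by have := uval_itv (k j); lra.
Qed.

Lemma of_cube_sphere k : sphere _ (of_cube k) <-> @cube_boundary R n k.
Proof.
split=> [k1|[j kj]].
  have /row_norm_attained[j] : `|of_cube k| != 0 by rewrite k1 oner_neq0.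
  rewrite k1 mxE => /esym/eqP; rewrite eqr_norml ler01 andbT => e.
  by exists j; case/orP: e => /eqP e; [right|left]; apply: uval_inj;
    rewrite ?uval0 ?uval1; lra.
apply/le_anti; rewrite of_cube_le1 /=.
apply: le_trans (row_norm_coord _ j); rewrite mxE.
by case: kj => ->; rewrite ?uval0 ?uval1 ?mulr0 ?sub0r ?normrN ?normr1//
  mulr1 -[2]/(1 + 1) addrK normr1.
Qed.

Lemma to_cube_boundary v : sphere _ v -> @cube_boundary R n (to_cube v).
Proof.
by move=> v1; apply/of_cube_sphere; rewrite to_cubeK// v1.
Qed.

End CubeBall.

(** * Homotopy groups in terms of balls *)

(** The cube, centered and scaled, is the unit ball of row vectors for the sup
    norm, and its boundary is the unit sphere. So loops are maps of the ball
    that are constant on the sphere. *)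
Section Loops.
Context {R : realType} (n : nat) (X : topologicalType) (x : X).

Lemma ball_homotopic_ext (E : normedModType R) (F F' G G' : E -> X) :
  (forall w, `|w| <= 1 -> F w = F' w) -> (forall w, `|w| <= 1 -> G w = G' w) ->
  ball_homotopic F G -> ball_homotopic F' G'.
Proof.
move=> FF GG [h [ch h0 h1 hs]]; exists h; split=> // [w w1|w w1|w t w1 t01].
- by rewrite h0// FF.
- by rewrite h1// GG.
- by rewrite hs// FF// w1.
Qed.

Definition ball_of_loop (a : loop R n x) (v : 'rV[R]_n) : X :=
  val a (to_cube v).

Lemma ball_of_loop_continuous a : continuous (ball_of_loop a).
Proof. exact: (cts_comp (@cts_fun _ _ (val a)) (@to_cube_continuous R n)). Qed.

Lemma ball_of_loop_sphere a v : sphere _ v -> ball_of_loop a v = x.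
Proof. by move=> /to_cube_boundary; exact: asboolW (valP a) _. Qed.

Lemma loop_of_ball (F : 'rV[R]_n -> X) : continuous F ->
  (forall v, sphere _ v -> F v = x) ->
  exists a : loop R n x, forall v, `|v| <= 1 -> ball_of_loop a v = F v.
Proof.
move=> cF Fx; have cc := cts_comp cF (@of_cube_continuous R n).
have ax : `[< forall t, cube_boundary t -> mkcts cc t = x >].
  by apply/asboolP => k /of_cube_sphere; exact: Fx.
exists (exist _ (mkcts cc : continuousType _ _) ax) => v v1.
by rewrite /ball_of_loop /= /mkcts to_cubeK.
Qed.

Lemma loop_homotopicP (a b : loop R n x) :
  loop_homotopic a b <-> ball_homotopic (ball_of_loop a) (ball_of_loop b).
Proof.
have cu := @uval_continuous R; have cc := @clamp_continuous R.
have ct := @to_cube_continuous R n; have co := @of_cube_continuous R n.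
split=> [/asboolP[H [H0 H1 Hb]]|[h [ch h0 h1 hs]]].
  have cH : continuous H by exact: cts_fun.
  exists (fun q => H (to_cube q.1, clamp q.2)); split=> /= [||w _|w t w1 _].
  - by cts.
  - by move=> w _; rewrite H0.
  - by rewrite H1.
  - by rewrite Hb//; exact: to_cube_boundary.
have cH : continuous (fun q : cube R n * unitI R => h (of_cube q.1, uval q.2)).
  by cts.
apply/asboolP; exists (mkcts cH); split=> [k|k|k s /of_cube_sphere k1].
- by rewrite /= /mkcts uval0 h0 ?of_cube_le1// /ball_of_loop of_cubeK.
- by rewrite /= /mkcts uval1 h1 ?of_cube_le1// /ball_of_loop of_cubeK.
- by rewrite /= /mkcts hs ?uval_itv// /ball_of_loop of_cubeK.
Qed.

End Loops.

Section Bijectivity.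
Context {R : realType}.

Lemma inj_surj_bij (A B : Type) (g : A -> B) :
  injective g -> (forall b, exists a, g a = b) -> bijective g.
Proof.
move=> gi /choice[h gh]; exists h => // a; exact/gi/gh.
Qed.

(** Injectivity on homotopy classes of maps of the ball of E that are constantly
    z on the sphere. *)
Definition ball_injective (E : normedModType R) (Z Y : topologicalType)
    (f : Z -> Y) (z : Z) : Prop :=
  forall a b : E -> Z, continuous a -> continuous b ->
    (forall w, sphere E w -> a w = z) -> (forall w, sphere E w -> b w = z) ->
    ball_homotopic (f \o a) (f \o b) -> ball_homotopic a b.

Lemma pi_map_bijectiveP (Z Y : topologicalType) (f : continuousType Z Y) n z :
  bijective (@pi_map R Z Y f n z) <->
  lifts f (fun _ : 'rV[R]_n => z) /\ ball_injective 'rV[R]_n f z.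
Proof.
have ballE (c : loop R n z) v : ball_of_loop (loop_map f c) v = f (ball_of_loop c v).
  by [].
have piE m (W : topologicalType) (w : W) (a b : loop R m w) :
    \pi_(pi_ R m w) a = \pi_(pi_ R m w) b <-> loop_homotopic a b.
  by split=> [/eqmodP|] // h; apply/eqmodP.
split=> [[g gK Kg]|[lf inj_f]].
  split=> [c cc cz|a b ca cb az bz fab].
    have [c' c'E] := loop_of_ball cc cz.
    pose a := repr (g (\pi_(pi_ R n (f z)) c')).
    exists (ball_of_loop a); split.
    - exact: ball_of_loop_continuous.
    - exact: ball_of_loop_sphere.
    - have /piE/loop_homotopicP : \pi_(pi_ R n (f z)) c' =
          \pi_(pi_ R n (f z)) (loop_map f a).
        by rewrite -pi_mapE /a reprK Kg.
      by apply: ball_homotopic_ext.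
  have [a' a'E] := loop_of_ball ca az.
  have [b' b'E] := loop_of_ball cb bz.
  have /piE/loop_homotopicP : \pi_(pi_ R n z) a' = \pi_(pi_ R n z) b'.
    apply: (can_inj gK); rewrite !pi_mapE; apply/piE/loop_homotopicP.
    by apply: ball_homotopic_ext fab => w w1; rewrite /= ballE ?a'E ?b'E.
  exact: ball_homotopic_ext.
apply: inj_surj_bij => [a b|c].
  rewrite -[a]reprK -[b]reprK !pi_mapE => /piE/loop_homotopicP fab.
  apply/piE/loop_homotopicP; apply: inj_f => //.
  - exact: ball_of_loop_continuous.
  - exact: ball_of_loop_continuous.
  - exact: ball_of_loop_sphere.
  - exact: ball_of_loop_sphere.
have [||a [ca az ac]] := lf (ball_of_loop (repr c)).
- exact: ball_of_loop_continuous.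
- exact: ball_of_loop_sphere.
have [a' a'E] := loop_of_ball ca az.
exists (\pi_(pi_ R n z) a'); rewrite pi_mapE -[c]reprK; apply/esym/piE.
apply/loop_homotopicP; apply: ball_homotopic_ext ac => // w w1.
by rewrite ballE a'E.
Qed.

(** In dimension 0 the sphere is empty, and the ball is a point. *)
Lemma path_related_ballP (X : topologicalType) (x y : X) :
  path_related R x y <->
  ball_homotopic (fun _ : 'rV[R]_0 => x) (fun _ : 'rV[R]_0 => y).
Proof.
split=> [/path_relatedP[H [H0 H1 _]]|[h [ch h0 h1 _]]].
  have cH : continuous H by exact: cts_fun.
  have cc := @clamp_continuous R.
  exists (fun q => H (zero, clamp q.2)); split=> [|w _|w _|w t /sphere_row0//] /=.
  - by cts.
  - by rewrite H0.
  - by rewrite H1.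
apply/path_relatedP; have cu := @uval_continuous R.
have cH : continuous (fun q : unitI R * unitI R => h (0, uval q.2)) by cts.
exists (mkcts cH); split=> [k|k|k s []] /=; rewrite /mkcts.
- by rewrite uval0 h0// normr0.
- by rewrite uval1 h1// normr0.
Qed.

(** Injectivity on path components is the case n = 0 of injectivity on homotopy
    groups. Surjectivity is not: lifts mentions a base point, which the source
    may lack. *)
Lemma pi0_map_bijectiveP (Z Y : topologicalType) (f : continuousType Z Y) :
  bijective (@pi0_map R Z Y f) <->
  (forall y, exists z, path_related R (f z) y) /\
  (forall z, ball_injective 'rV[R]_0 f z).
Proof.
have piE (W : topologicalType) (a b : W) :
    \pi_(pi0 R W) a = \pi_(pi0 R W) b <-> path_related R a b.
  by split=> [/eqmodP|] // h; apply/eqmodP.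
split=> [[g gK Kg]|[surj_f inj_f]].
  split=> [y|_ a b ca cb _ _ fab].
    exists (repr (g (\pi_(pi0 R Y) y))); apply/piE.
    by rewrite -pi0_mapE reprK Kg.
  have aE : a = fun=> a 0 by apply/funext => v; rewrite [v]thinmx0.
  have bE : b = fun=> b 0 by apply/funext => v; rewrite [v]thinmx0.
  rewrite aE bE; apply/path_related_ballP/piE/(can_inj gK).
  rewrite !pi0_mapE; apply/piE/path_related_ballP.
  by move: fab; rewrite aE bE.
apply: inj_surj_bij => [a b|c].
  rewrite -[a]reprK -[b]reprK !pi0_mapE => /piE/path_related_ballP fab.
  apply/piE/path_related_ballP; apply: (inj_f (repr a)) fab.
  - exact: cts_cst.
  - exact: cts_cst.
  - by move=> w /sphere_row0.
  - by move=> w /sphere_row0.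
have [z zc] := surj_f (repr c); exists (\pi_(pi0 R Z) z).
by rewrite pi0_mapE -[c]reprK; apply/piE.
Qed.

End Bijectivity.

(** * Homotopies as maps of a ball of one more dimension *)

Section Cylinder.
Context {R : realType} (E : normedModType R) (X : topologicalType).

Lemma sphere_prodP (v : E) (s : R) : sphere (E * R)%type (v, s) <->
  (`|v| <= 1 /\ `|s| = 1) \/ (`|v| = 1 /\ `|s| <= 1).
Proof.
rewrite /sphere /= prod_normE /=; split=> [e|].
  have vs : `|v| <= 1 /\ `|s| <= 1 by rewrite -e !le_max !lexx orbT.
  by move: e; case: (leP `|v| `|s|) => _ e; [left|right]; split=> //; case: vs.
by move=> [[v1 ->]|[-> s1]]; [exact/max_idPr|exact/max_idPl].
Qed.

(** The map on the sphere of E * R given by a on the bottom, by b on the top,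
    and by their common value on the sides, where it may be computed by a or b
    alike. *)
Definition cylinder (a b : E -> X) (q : E * R) : X :=
  if q.2 <= 0 then a q.1 else b q.1.

Lemma cylinder_within (a b : E -> X) : continuous a -> continuous b ->
  (forall v, sphere E v -> a v = b v) ->
  {within sphere (E * R)%type, continuous (cylinder a b)}.
Proof.
move=> ca cb ab.
pose A := [set q : E * R | q.2 <= 0]; pose B := [set q : E * R | 0 <= q.2].
have cS : closed (sphere (E * R)%type).
  have -> : sphere (E * R)%type = [set q : E * R | `|q| <= 1] `&` [set q | 1 <= `|q|].
    apply/seteqP; split=> q; rewrite /sphere /=; first by move=> ->.
    by move=> /andP/le_anti.
  by apply: closedI; apply: closed_le_fun; cts.
have -> : sphere (E * R)%type =
    (sphere (E * R)%type `&` A) `|` (sphere (E * R)%type `&` B).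
  apply/seteqP; split=> q; last by move=> [[]|[]].
  by move=> q1; case: (leP q.2 0) => [?|/ltW ?]; [left|right].
apply: withinU_continuous.
- by apply: closedI => //; apply: closed_le_fun; cts.
- by apply: closedI => //; apply: closed_le_fun; cts.
- apply: (@within_eq (E * R)%type X _ (fun q => a q.1)).
    by move=> q [_ qA]; rewrite /cylinder ifT.
  by apply: continuous_subspaceT; cts.
- apply: (@within_eq (E * R)%type X _ (fun q => b q.1)).
    move=> [v s] [q1 qB]; rewrite /cylinder; case: ifP => //= s0.
    have {}s0 : s = 0 by apply/le_anti; rewrite s0.
    rewrite s0 in q1.
    have [[_ /eqP]|[v1 _]] := (sphere_prodP v 0).1 q1; last by rewrite ab.
    by rewrite normr0 eq_sym oner_eq0.
  by apply: continuous_subspaceT; cts.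
Qed.

(** So injectivity of f in dimension n is a question of extending maps over a
    ball of dimension n + 1. *)
Lemma ball_homotopic_cylinder (a b : E -> X) :
  (forall v, sphere E v -> a v = b v) ->
  ball_homotopic a b <-> exists c : E * R -> X, continuous c /\
    forall q, sphere (E * R)%type q -> c q = cylinder a b q.
Proof.
move=> ab; split=> [[h [ch h0 h1 hs]]|[c [cc ccyl]]].
  exists (fun q => h (q.1, (q.2 + 1) / 2)); split; first by cts.
  move=> [v s] /sphere_prodP[[v1 /eqP]|[v1]]; rewrite /cylinder /=.
    rewrite eqr_norml ler01 andbT => /orP[] /eqP ->.
      by rewrite ler10 -[1 + 1]/(2 : R) divff ?pnatr_eq0// h1.
    by rewrite lerN10 addNr mul0r h0.
  rewrite ler_norml => /andP[s0 s1]; rewrite hs//; last by lra.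
  by case: ifP => // _; rewrite ab.
exists (fun q => c (q.1, 2 * q.2 - 1)); split; first by cts.
- move=> v v1; rewrite ccyl /cylinder /=; last by apply/sphere_prodP; left;
    rewrite mulr0 sub0r normrN normr1.
  by rewrite mulr0 sub0r lerN10.
- move=> v v1; rewrite ccyl /cylinder /=; last by apply/sphere_prodP; left;
    rewrite mulr1 -[2]/(1 + 1) addrK normr1.
  by rewrite mulr1 -[2]/(1 + 1) addrK ler10.
- move=> v t v1 t01; rewrite ccyl /cylinder /=.
    by case: ifP => // _; rewrite ab.
  by apply/sphere_prodP; right; split=> //; rewrite ler_norml; lra.
Qed.

End Cylinder.

Section ProductBall.
Context {R : realType} (n : nat).

Definition to_product (u : 'rV[R]_n.+1) : 'rV[R]_n * R :=
  (\row_j u ord0 (lift ord0 j), u ord0 ord0).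

Definition of_product (q : 'rV[R]_n * R) : 'rV[R]_n.+1 :=
  \row_j (if unlift ord0 j is Some j' then q.1 ord0 j' else q.2).

Lemma of_productK : cancel of_product to_product.
Proof.
move=> [v s]; rewrite /to_product mxE unlift_none; congr pair.
by apply/rowP => j; rewrite !mxE liftK.
Qed.

Lemma to_product_continuous : continuous to_product.
Proof.
apply: cts_pair.
  by apply: row_continuous => j; exact: (@coord_continuous R 1 n.+1 ord0).
exact: (@coord_continuous R 1 n.+1 ord0).
Qed.

Lemma of_product_continuous : continuous of_product.
Proof.
apply: row_continuous => j; case: unlift => [j'|]; last by cts.
exact: (cts_comp (@coord_continuous R 1 n ord0 j') (cts_fst cts_id)).
Qed.

Lemma of_product_norm q : `|of_product q| = `|q|.
Proof.
case: q => v s; rewrite prod_normE /=; apply/le_anti/andP; split.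
  apply/row_norm_le; first by rewrite le_max normr_ge0.
  move=> j; rewrite mxE le_max; case: unlift => [j'|]; last by rewrite lexx orbT.
  by rewrite row_norm_coord.
rewrite ge_max; apply/andP; split.
  apply/row_norm_le => // j; apply: le_trans (row_norm_coord _ (lift ord0 j)).
  by rewrite mxE liftK.
apply: le_trans (row_norm_coord _ ord0).
by rewrite mxE unlift_none.
Qed.

Lemma to_product_norm u : `|to_product u| = `|u|.
Proof.
rewrite -of_product_norm; congr `|_|; apply/rowP => j; rewrite mxE.
by case: unliftP => [j'|] ->; rewrite ?mxE.
Qed.

Lemma lifts_product (Z Y : topologicalType) (f : Z -> Y) (z : Z) :
  lifts f (fun _ : 'rV[R]_n.+1 => z) -> lifts f (fun _ : 'rV[R]_n * R => z).
Proof.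
move=> lf c cc cz; have ct := to_product_continuous.
have co := of_product_continuous.
have [||g [cg gz [h [ch h0 h1 hs]]]] := lf (fun u => c (to_product u)).
- by cts.
- by move=> u u1; rewrite cz// /sphere /= to_product_norm.
exists (fun q => g (of_product q)); split.
- by cts.
- by move=> q q1; rewrite gz// /sphere /= of_product_norm.
exists (fun p => h (of_product p.1, p.2)); split.
- by cts.
- by move=> q q1; rewrite /= h0 ?of_product_norm// of_productK.
- by move=> q q1; rewrite /= h1 ?of_product_norm.
- move=> q t q1 t01; rewrite /= hs ?of_productK//.
  by rewrite /sphere /= of_product_norm.
Qed.

End ProductBall.

(** * The projections of the homotopy limit *)

Section Projection.
Context {R : realType} (X : tower R).

Lemma bond_injective i m z : (i <= m)%N -> ball_injective 'rV[R]_i (bond X m) z.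
Proof.
have [b0 bi] := bond_weq X m; case: i => [_|i im].
  by have [_] := (pi0_map_bijectiveP _).1 b0; exact.
by have [] := (pi_map_bijectiveP _ _ _).1 (bi i.+1 im z).
Qed.

Lemma bond_lifts i m z : (0 < i <= m)%N ->
  lifts (bond X m) (fun _ : 'rV[R]_i => z).
Proof.
move=> im; have [_ bi] := bond_weq X m.
by have [] := (pi_map_bijectiveP _ _ _).1 (bi i im z).
Qed.

Lemma lifts_ext (E : normedModType R) (Z Y : topologicalType) (f : Z -> Y)
    (phi psi : E -> Z) :
  (forall w, sphere E w -> phi w = psi w) -> lifts f phi -> lifts f psi.
Proof.
move=> pp lf c cc cpsi.
have [|g [cg gphi fg]] := lf c cc; first by move=> w w1; rewrite pp// cpsi.
by exists g; split=> // w w1; rewrite -pp// gphi.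
Qed.

Lemma cylinder_comp (E : normedModType R) (Z Y : topologicalType) (f : Z -> Y)
    (a b : E -> Z) q : f (cylinder a b q) = cylinder (f \o a) (f \o b) q.
Proof. by rewrite /cylinder; case: ifP. Qed.

Section Injectivity.
Context (i : nat) (p : holim X) (a b : 'rV[R]_i -> holim X).
Hypotheses (ca : continuous a) (cb : continuous b).
Hypotheses (ap : forall v, sphere _ v -> a v = p).
Hypotheses (bp : forall v, sphere _ v -> b v = p).

Let ab v : sphere _ v -> a v = b v.
Proof. by move=> v1; rewrite ap// bp. Qed.

Let comp_ab Y (f : holim X -> Y) v : sphere _ v -> (f \o a) v = (f \o b) v.
Proof. by move=> v1; rewrite /= ab. Qed.

Let bond_point_inj m : (i <= m)%N ->
  ball_homotopic (bond X m \o (@point_at _ X m.+1 \o a))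
                 (bond X m \o (@point_at _ X m.+1 \o b)) ->
  ball_homotopic (@point_at _ X m.+1 \o a) (@point_at _ X m.+1 \o b).
Proof.
move=> im; apply: (bond_injective (z := point_at m.+1 p) im).
- exact: (cts_comp (@point_at_continuous _ X _) ca).
- exact: (cts_comp (@point_at_continuous _ X _) cb).
- by move=> v v1; rewrite /= ap.
- by move=> v v1; rewrite /= bp.
Qed.

Lemma point_homotopic_extends m :
  ball_homotopic (@point_at _ X m \o a) (@point_at _ X m \o b) ->
  exists c, extends_point (n := m) (cylinder a b) c.
Proof.
move=> /(ball_homotopic_cylinder (@comp_ab _ _))[c [cc ccyl]].
by exists c; split=> // q q1; rewrite ccyl// cylinder_comp.
Qed.

(** In dimension i = m the next bonding map need not be surjective on homotopy
    groups of dimension i + 1, so that the lifting argument below is not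
    available at level m. This step passes to level m + 1, where it is. *)
Lemma point_homotopic_up m : (i <= m)%N ->
  ball_homotopic (@point_at _ X m \o a) (@point_at _ X m \o b) ->
  ball_homotopic (@point_at _ X m.+1 \o a) (@point_at _ X m.+1 \o b).
Proof.
move=> im /point_homotopic_extends[c cab].
have [K [cK K0 Kd]] := transport (cylinder_within ca cb ab) cab.
apply: bond_point_inj => //.
apply/(ball_homotopic_cylinder (@comp_ab _ (bond X m \o @point_at _ X m.+1))).
exists (fun q => K (q, 1)); split; first by cts.
move=> q q1; rewrite Kd ?ler01 ?lexx// /boundary_path path_at1.
by rewrite !cylinder_comp.
Qed.

(** A homotopy of the N-th components extends to one in the homotopy limit.
    At level m >= N, injectivity of the bonding map in dimension i gives some
    homotopy between the next components; surjectivity in dimension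
    i + 1 <= m corrects it until it is compatible with the one at level m. This
    is why no derived limit of homotopy groups appears. *)
Lemma homotopic_of_point_homotopic N : (i < N)%N ->
  ball_homotopic (@point_at _ X N \o a) (@point_at _ X N \o b) ->
  ball_homotopic a b.
Proof.
move=> iN /point_homotopic_extends[c cab].
apply/(ball_homotopic_cylinder ab).
have [m Nm|Phi [cPhi Phiab _]] := tower_lift (cylinder_within ca cb ab) cab;
  last by exists Phi.
move=> d cd dab.
have /point_homotopic_extends[g [cg gab]] :
    ball_homotopic (@point_at _ X m.+1 \o a) (@point_at _ X m.+1 \o b).
  apply: bond_point_inj; first exact: leq_trans (ltnW iN) Nm.
  apply/(ball_homotopic_cylinder (@comp_ab _ (bond X m \o @point_at _ X m.+1))).
  by exists d; split=> // q q1; rewrite dab// !cylinder_comp.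
apply: (lifts_ext gab) cd dab; apply: lifts_extend => //.
  exact: cts_fun.
apply: lifts_product; apply: bond_lifts.
exact: leq_trans iN Nm.
Qed.

End Injectivity.

Lemma point_at_lifts i n (p : holim X) : (0 < i <= n)%N ->
  lifts (@point_at _ X n) (fun _ : 'rV[R]_i => p).
Proof.
move=> /andP[i0 in_] c cc cp.
have cphi : {within sphere 'rV[R]_i, continuous (fun=> p)}.
  by apply: continuous_subspaceT; exact: cts_cst.
have cext : extends_point (fun=> p) c by split.
have [m nm|Phi [cPhi Phip Phic]] := tower_lift cphi cext.
  by apply: bond_lifts; rewrite i0 (leq_trans in_ nm).
exists Phi; split=> //; exists (fun q => c q.1); split=> //.
- by cts.
- by move=> v v1; rewrite /= Phic.
Qed.

Lemma point_at_injective i n (p : holim X) : (i <= n)%N ->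
  ball_injective 'rV[R]_i (@point_at _ X n) p.
Proof.
move=> in_ a b ca cb ap bp ab.
apply: (homotopic_of_point_homotopic ca cb ap bp (N := n.+1)) => //.
exact: (point_homotopic_up ca cb ap bp in_ ab).
Qed.

(** The homotopy limit may be empty as far as is known here, so the point is
    built from y alone. *)
Lemma point_at_surjective n (y : X n) :
  exists p : holim X, path_related R (point_at n p) y.
Proof.
have bond_surj m (x : X m) : exists z, path_related R (bond X m z) x.
  have [b0 _] := bond_weq X m.
  by have [+ _] := (pi0_map_bijectiveP _).1 b0; exact.
have [m x _|m z _|x [xn xb]] := @dependent_choice_from (fun m => X m : Type)
  (fun m x z => path_related R x (bond X m z)) n y.
- by have [z zx] := bond_surj m x; exists z; rewrite path_related_sym.
- by exists (bond X m z); exact: path_related_refl.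
have [K /all_and3[cK K0 K1]] : exists K : forall m, 'rV[R]_0 * R -> X m,
    forall m, [/\ continuous (K m), forall w, K m (w, 0) = x m &
    forall w, K m (w, 1) = bond X m (x m.+1)].
  have h m : exists K : 'rV[R]_0 * R -> X m, [/\ continuous K,
      forall w, K (w, 0) = x m & forall w, K (w, 1) = bond X m (x m.+1)].
    have /path_related_ballP[K [cK K0 K1 _]] := xb m.
    by exists K; split=> // w; [apply: K0|apply: K1]; rewrite [w]thinmx0 normr0.
  by exists (fun m => projT1 (cid (h m))) => m; exact: projT2 (cid (h m)).
have K1' m w : K m (w, 1) = bond X m (K m.+1 (w, 0)) by rewrite K1 K0.
exists (build cK K1' 0); rewrite build_point K0 xn.
exact: path_related_refl.
Qed.

Theorem holim_proj_n_equivalence n : @n_equivalence R n _ _ (holim_proj X n).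
Proof.
split.
  apply/pi0_map_bijectiveP; split; first exact: point_at_surjective.
  by move=> p; exact: point_at_injective.
move=> i in_ p; apply/pi_map_bijectiveP; split; first exact: point_at_lifts.
by apply: point_at_injective; case/andP: in_.
Qed.

End Projection.

(** * Two out of three, and tails of a tower *)

Section TwoOfThree.
Context {R : realType} (X Y Z : topologicalType).
Context (f : continuousType X Y) (g : continuousType Y Z).

Let gf : continuousType X Z := g \o f.

Lemma pi0_map_comp : @pi0_map R _ _ gf =1 @pi0_map R _ _ g \o @pi0_map R _ _ f.
Proof. by elim/quotW => x; rewrite [LHS]pi0_mapE /= (@pi0_mapE R _ _ f) pi0_mapE. Qed.

Lemma pi_map_comp i x :
  @pi_map R _ _ gf i x =1 @pi_map R _ _ g i (f x) \o @pi_map R _ _ f i x.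
Proof.
elim/quotW => a; rewrite [LHS]pi_mapE /= (@pi_mapE R _ _ f) pi_mapE; congr (\pi _).
by apply/val_inj/continuousEP.
Qed.

Lemma n_equivalence_comp n : @n_equivalence R n _ _ f ->
  @n_equivalence R n _ _ g -> @n_equivalence R n _ _ gf.
Proof.
move=> [f0 fi] [g0 gi]; split.
  by apply: (eq_bij (bij_comp g0 f0)) => c; rewrite pi0_map_comp.
move=> i in_ x.
by apply: (eq_bij (bij_comp (gi i in_ (f x)) (fi i in_ x))) => c;
  rewrite pi_map_comp.
Qed.

Lemma bij_cancel (A B C : Type) (u : A -> B) (v : B -> C) (w : A -> C) :
  w =1 v \o u -> bijective v -> bijective w -> bijective u.
Proof.
move=> wE [v' vK v'K] [w' wK w'K]; exists (w' \o v) => a /=.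
  by have := wE a => /= <-.
by apply: (can_inj vK); have := wE (w' (v a)) => /= <-; rewrite w'K.
Qed.

Lemma n_equivalence_cancel n : @n_equivalence R n _ _ g ->
  @n_equivalence R n _ _ gf -> @n_equivalence R n _ _ f.
Proof.
move=> [g0 gi] [h0 hi]; split; first exact: bij_cancel pi0_map_comp g0 h0.
by move=> i in_ x; apply: bij_cancel (@pi_map_comp i x) (gi _ in_ _) (hi _ in_ _).
Qed.

Lemma weak_equivalenceP : @weak_equivalence R _ _ f <->
  forall n, @n_equivalence R n _ _ f.
Proof.
split=> [fw n|fn]; first exact: weak_equivalenceW.
split; first by have [] := fn 0%N.
by move=> i i0 x; have [_] := fn i; apply; rewrite i0 leqnn.
Qed.

End TwoOfThree.

Section Tail.
Context {R : realType}.
Implicit Types X Y Z : tower R.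

Lemma n_equivalenceS n (X Y : topologicalType) (f : continuousType X Y) :
  @n_equivalence R n.+1 _ _ f -> @n_equivalence R n _ _ f.
Proof.
move=> [f0 fi]; split=> // i /andP[i0 in_]; apply: fi.
by rewrite i0 leqW.
Qed.

Definition tail X : tower R :=
  @Tower R (fun n => X n.+1) (fun n => bond X n.+1)
    (fun n => n_equivalenceS (bond_weq X n.+1)).

Definition tail_map X Y (f : tower_map X Y) : tower_map (tail X) (tail Y) :=
  @TowerMap R (tail X) (tail Y) (fun n => f n.+1)
    (fun n x => level_map_bond f x).

Definition prepend_homotopy X n : holim (tail X) * R -> X n :=
  match n with
  | 0 => fun q => bond X 0 (@point_at R (tail X) 0 q.1)
  | n'.+1 => fun q => @path_at R (tail X) n' q.1 q.2
  end.

Lemma prepend_homotopy_continuous X n : continuous (@prepend_homotopy X n).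
Proof.
case: n => [|n] /=; last exact: (@path_at_continuous R (tail X) n).
have cp := @point_at_continuous R (tail X) 0.
have cb : continuous (bond X 0) by exact: cts_fun.
exact: (cts_comp cb (cts_comp cp (cts_fst cts_id))).
Qed.

Lemma prepend_homotopy1 X n v :
  prepend_homotopy n (v, 1) = bond X n (prepend_homotopy n.+1 (v, 0)).
Proof. by case: n => [|n] /=; rewrite ?path_at1 path_at0. Qed.

(** Extends a point of the microscope of the tail to level 0, by the image of
    its first coordinate and the constant path. *)
Definition prepend X : continuousType (holim (tail X)) (holim X) :=
  mkcts (@build_continuous R X _ _ (@prepend_homotopy_continuous X)
    (@prepend_homotopy1 X)).

Lemma prepend_point0 X p :
  point_at 0 (prepend X p) = bond X 0 (@point_at R (tail X) 0 p).
Proof. by []. Qed.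

Lemma prepend_pointS X n p :
  point_at n.+1 (prepend X p) = @point_at R (tail X) n p.
Proof. by rewrite [LHS]path_at0. Qed.

(** The (n + 1)-st projection of the tower composed with prepend is the n-th
    projection of the tail, and both projections are n-equivalences. *)
Lemma prepend_weak_equivalence X : @weak_equivalence R _ _ (prepend X).
Proof.
apply/weak_equivalenceP => n.
apply: (@n_equivalence_cancel _ _ _ _ (prepend X) (holim_proj X n.+1)).
  exact/n_equivalenceS/holim_proj_n_equivalence.
have -> : (holim_proj X n.+1 \o prepend X : continuousType _ _) =
    holim_proj (tail X) n.
  by apply/continuousEP => p; exact: prepend_pointS.
exact: holim_proj_n_equivalence.
Qed.

Lemma holim_map_path X Y (f : tower_map X Y) n p t :
  path_at n (holim_map f p) t = f n (path_at n p t).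
Proof. by []. Qed.

Lemma prepend_natural X Y (f : tower_map X Y) p :
  prepend Y (holim_map (tail_map f) p) = holim_map f (prepend X p).
Proof.
apply: holim_ext => -[|n] t t01; rewrite holim_map_path.
  rewrite [LHS]build_path [X in _ = f _ X]build_path /=.
  by rewrite level_map_bond.
by rewrite [LHS]build_path [X in _ = f _ X]build_path /=.
Qed.

End Tail.

(** * The zigzag between a tower and its homotopy limit *)

Section Zigzag.
Context {R : realType}.
Implicit Types X Y Z : tower R.

(** The recursion is on the inner tower, so that no level is ever renamed along
    an equation between natural numbers. *)
Fixpoint iter_tail n X : tower R :=
  if n is n'.+1 then iter_tail n' (tail X) else X.

Fixpoint iter_tail_map n X Y (f : tower_map X Y) :
    tower_map (iter_tail n X) (iter_tail n Y) :=
  match n return tower_map (iter_tail n X) (iter_tail n Y) with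
  | 0 => f
  | n'.+1 => iter_tail_map n' (tail_map f)
  end.

Fixpoint iter_prepend n X :
    continuousType (holim (iter_tail n.+1 X)) (holim (iter_tail n X)) :=
  match n return
    continuousType (holim (iter_tail n.+1 X)) (holim (iter_tail n X)) with
  | 0 => prepend X
  | n'.+1 => iter_prepend n' (tail X)
  end.

(** The composite of the maps iter_prepend from level n to level 0. *)
Fixpoint collapse n X : continuousType (holim (iter_tail n X)) (holim X) :=
  match n return continuousType (holim (iter_tail n X)) (holim X) with
  | 0 => idfun
  | n'.+1 => prepend X \o collapse n' (tail X)
  end.

Lemma iter_prepend_weak_equivalence n X :
  @weak_equivalence R _ _ (iter_prepend n X).
Proof.
by elim: n X => [|n IH] X; [exact: prepend_weak_equivalence|exact: IH].
Qed.

Lemma collapse_weak_equivalence n X : @weak_equivalence R _ _ (collapse n X).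
Proof.
elim: n X => [|n IH] X; first exact: weak_equivalence_idfun.
apply/weak_equivalenceP => m; apply: n_equivalence_comp.
  exact: weak_equivalenceW (IH _).
exact: weak_equivalenceW (@prepend_weak_equivalence R X).
Qed.

Lemma collapse_prepend n X p :
  collapse n X (iter_prepend n X p) = collapse n.+1 X p.
Proof. by elim: n X p => [|n IH] X p //; exact: congr1 (IH _ _). Qed.

(** The path at n has been made constant, so that the projection to X n commutes
    strictly with the bonding maps, which it does not on holim X. *)
Lemma collapse_point n X p :
  point_at n (collapse n.+1 X p) = bond X n (point_at n.+1 (collapse n.+1 X p)).
Proof.
elim: n X p => [|n IH] X p; first by
  exact: etrans (prepend_point0 p) (congr1 _ (esym (prepend_pointS 0 p))).
rewrite -[collapse _ _ _]/(prepend X (collapse n.+1 (tail X) p)).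
pose q := collapse n.+1 (tail X) p.
exact: (etrans (prepend_pointS n q) (etrans (IH (tail X) p)
  (congr1 (bond X n.+1) (esym (prepend_pointS n.+1 q))))).
Qed.

Lemma iter_prepend_natural n X Y (f : tower_map X Y) p :
  iter_prepend n Y (holim_map (iter_tail_map n.+1 f) p) =
  holim_map (iter_tail_map n f) (iter_prepend n X p).
Proof.
elim: n X Y f p => [|n IH] X Y f p; first exact: prepend_natural.
exact: IH.
Qed.

Lemma collapse_natural n X Y (f : tower_map X Y) p :
  collapse n Y (holim_map (iter_tail_map n f) p) = holim_map f (collapse n X p).
Proof.
elim: n X Y f p => [|n IH] X Y f p //=.
by rewrite -prepend_natural -IH.
Qed.

(** The middle of the zigzag: its level n is a copy of the subspace of holim X
    where the paths below n are constant. It maps strictly both to the constant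
    tower on holim X and to X. *)
Definition tails X : tower R :=
  @Tower R (fun n => holim (iter_tail n X)) (fun n => iter_prepend n X)
    (fun n => weak_equivalenceW n (@iter_prepend_weak_equivalence n X)).

Definition tails_map X Y (f : tower_map X Y) : tower_map (tails X) (tails Y) :=
  @TowerMap R (tails X) (tails Y) (fun n => holim_map (iter_tail_map n f))
    (fun n p => esym (iter_prepend_natural f p)).

Lemma iter_tail_map_id n X : iter_tail_map n (tower_id X) = tower_id (iter_tail n X).
Proof.
elim: n X => [|n IH] X //=; rewrite -IH; congr iter_tail_map.
exact: tower_mapP.
Qed.

Lemma iter_tail_map_comp n X Y Z (g : tower_map Y Z) (f : tower_map X Y) :
  iter_tail_map n (tower_comp g f) =
  tower_comp (iter_tail_map n g) (iter_tail_map n f).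
Proof.
elim: n X Y Z g f => [|n IH] X Y Z g f //=; rewrite -IH; congr iter_tail_map.
exact: tower_mapP.
Qed.

Program Definition tails_functor : functor (Lim R) (Lim R) :=
  @Functor (Lim R) (Lim R) tails tails_map _ _.
Next Obligation.
move=> X; apply: tower_mapP => n p; rewrite /= iter_tail_map_id.
by have /continuousEP/(_ p) := @fmor_idm _ _ (holim_functor R) (iter_tail n X).
Qed.
Next Obligation.
move=> X Y Z g f; apply: tower_mapP => n p; rewrite /= iter_tail_map_comp.
by have /continuousEP/(_ p) :=
  @fmor_cmp _ _ (holim_functor R) _ _ _ (iter_tail_map n g) (iter_tail_map n f).
Qed.

Definition tails_to_const X : tower_map (tails X) (const_tower R (holim X)) :=
  @TowerMap R (tails X) (const_tower R (holim X)) (fun n => collapse n X)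
    (fun n p => collapse_prepend p).

Program Definition tails_to_levels X : tower_map (tails X) X :=
  @TowerMap R (tails X) X
    (fun n => holim_proj X n \o collapse n X : continuousType _ _) _.
Next Obligation.
by move=> X n p /=; rewrite collapse_prepend; exact: collapse_point.
Qed.

Lemma tails_const_holim :
  $|natural_weq tails_functor
      (comp_functor (const_functor R) (holim_functor R))|.
Proof.
apply: squash; apply: (@NaturalWeq (Lim R) (Lim R) tails_functor
  (comp_functor (const_functor R) (holim_functor R)) tails_to_const).
  move=> X Y f; apply: tower_mapP => n p /=; exact: collapse_natural.
move=> X n; exact: weak_equivalenceW (@collapse_weak_equivalence n X).
Qed.

Lemma tails_id : $|natural_weq tails_functor (id_functor (Lim R))|.
Proof.
apply: squash; apply: (@NaturalWeq (Lim R) (Lim R) tails_functor (id_functor (Lim R))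
  tails_to_levels).
  move=> X Y f; apply: tower_mapP => n p /=.
  by rewrite collapse_natural.
move=> X n; apply: n_equivalence_comp; last exact: holim_proj_n_equivalence.
exact: weak_equivalenceW (@collapse_weak_equivalence n X).
Qed.

Lemma const_homotopy_continuous (X : topologicalType) :
  continuous (fun q : X * R => q.1).
Proof. by cts. Qed.

Definition to_holim_const (X : topologicalType) :
    continuousType X (holim (const_tower R X)) :=
  mkcts (@build_continuous R (const_tower R X) X (fun _ q => q.1)
    (fun=> @const_homotopy_continuous X) (fun _ _ => erefl)).

Lemma to_holim_const_weak_equivalence (X : topologicalType) :
  @weak_equivalence R _ _ (to_holim_const X).
Proof.
apply/weak_equivalenceP => n.
apply: n_equivalence_cancel (@holim_proj_n_equivalence R (const_tower R X) n) _.
have -> : (holim_proj (const_tower R X) n \o to_holim_const X :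
    continuousType _ _) = (idfun : continuousType X X).
  exact/continuousEP.
exact/weak_equivalenceW/weak_equivalence_idfun.
Qed.

Lemma id_holim_const : $|natural_weq (id_functor (Top R))
  (comp_functor (holim_functor R) (const_functor R))|.
Proof.
apply: squash; apply: (@NaturalWeq (Top R) (Top R) (id_functor (Top R))
  (comp_functor (holim_functor R) (const_functor R)) to_holim_const).
  by move=> X Y f; apply/continuousEP => x; exact: holim_eqP.
exact: to_holim_const_weak_equivalence.
Qed.

Lemma const_homotopical : homotopical (const_functor R).
Proof. by move=> X Y f fw n; exact: weak_equivalenceW. Qed.

Lemma holim_homotopical : homotopical (holim_functor R).
Proof.
move=> X Y f fw; apply/weak_equivalenceP => n.
apply: n_equivalence_cancel (@holim_proj_n_equivalence R Y n) _.
have -> : (holim_proj Y n \o holim_map f : continuousType _ _) =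
    (f n \o holim_proj X n : continuousType _ _) by exact/continuousEP.
apply: n_equivalence_comp; first exact: holim_proj_n_equivalence.
exact: fw.
Qed.

Lemma naturally_weakly_equivalent_objects (C D : relCat) (F G : functor C D) a :
  naturally_weakly_equivalent F G -> weakly_equivalent (F a) (G a).
Proof.
elim=> [F1 F2 [h]|F1|F1 F2 _ IH|F1 F2 F3 _ IH1 _ IH2].
- by apply: rst_step; exists (component h a); exact: component_weq.
- exact: rst_refl.
- exact: rst_sym.
- exact: rst_trans IH1 IH2.
Qed.

End Zigzag.

Theorem mainTheorem2 (R : realType) :
  [/\ homotopy_equivalence (const_functor R) (holim_functor R),
      (forall X : Top R,
         weakly_equivalent (holim_functor R (const_functor R X)) X),
      (forall X : Lim R,
         weakly_equivalent X (const_functor R (holim_functor R X))) &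
      (forall (X : tower R) (n : nat), @weq (Top_le R n) _ _ (holim_proj X n))].
Proof.
have holim_const : naturally_weakly_equivalent
    (comp_functor (holim_functor R) (const_functor R)) (id_functor (Top R)).
  by apply/rst_sym/rst_step; exact: id_holim_const.
have const_holim : naturally_weakly_equivalent
    (comp_functor (const_functor R) (holim_functor R)) (id_functor (Lim R)).
  apply: (@rst_trans _ _ _ (@tails_functor R)).
    by apply/rst_sym/rst_step; exact: tails_const_holim.
  by apply: rst_step; exact: tails_id.
split=> [|X|X|X n].
- by split=> //; [exact: const_homotopical|exact: holim_homotopical].
- exact: (naturally_weakly_equivalent_objects X holim_const).
- exact/rst_sym/(naturally_weakly_equivalent_objects X const_holim).
- exact: holim_proj_n_equivalence.
Qed.
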